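(* Let $m\in\mathbb{N}_0$, let $\psi:(-\frac12,\frac12)\to\mathbb{R}$ be a transformation with density function $\varrho$, let $\omega:\mathbb{R}\to[0,\infty)$ be a non-negative weight function, let $h\in L_2(\mathbb{R},\omega)\cap H^m(\mathbb{R})$, and let $$f(x):=h(\psi(x))\,\sqrt{\omega(\psi(x))\,\psi'(x)},\qquad x\in\mathbb{T},$$ be the corresponding transformed function. If for all $\ell=0,1,\ldots,m$ we have $$\frac{\mathrm{d}^\ell}{\mathrm{d}y^\ell}[\varrho](y)\in\mathcal{C}_0(\mathbb{R}),\qquad \frac{\mathrm{d}^\ell}{\mathrm{d}x^\ell}[\psi](x)\in\mathcal{C}\left((-\tfrac12,\tfrac12)\right)$$ and $$\max_{k=0,\ldots,\ell}\left\|\frac{\mathrm{d}^{\ell-k}}{\mathrm{d}x^{\ell-k}}\left[\sqrt{(\omega\circ\psi)\,\psi'}\right](x)\;\psi'(x)^{\max(-\frac12,\,2k-\frac32)}\right\|_{L_\infty(\mathbb{T})}<\infty,$$ then $f\in H^m(\mathbb{T})$.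
   Context: $\mathbb{T}\simeq[-\frac12,\frac12)$ is the one-dimensional torus. A transformation is a map $\psi:(-\frac12,\frac12)\to\mathbb{R}$ that is continuously differentiable, strictly increasing, odd, and satisfies $\lim_{x\to-1/2}\psi(x)=-\infty$ and $\lim_{x\to1/2}\psi(x)=\infty$; its inverse $\psi^{-1}:\mathbb{R}\to(-\frac12,\frac12)$ is also continuously differentiable and increasing. The density function of $\psi$ is $\varrho(y):=(\psi^{-1})'(y)=\frac{1}{\psi'(\psi^{-1}(y))}$, $y\in\mathbb{R}$. $\mathcal{C}_0(\mathbb{R})$ is the space of continuous functions $\mathbb{R}\to\mathbb{C}$ vanishing at infinity, and $\mathcal{C}((-\frac12,\frac12))$ is the space of continuous functions on $(-\frac12,\frac12)$. The weighted space is $L_2(\mathbb{R},\omega)=\{h\in L_2(\mathbb{R}):\|h\|_{L_2(\mathbb{R},\omega)}:=(\int_{\mathbb{R}}|h(y)|^2\omega(y)\,\mathrm{d}y)^{1/2}<\infty\}$. For $\Omega\in\{\mathbb{T},\mathbb{R}\}$ the Sobolev space is $H^m(\Omega)=\{f\in L_2(\Omega):\|f\|_{H^m(\Omega)}<\infty\}$ with $\|f\|_{H^m(\Omega)}:=\left(\sum_{k=0}^m\|f^{(k)}\|_{L_2(\Omega)}^2\right)^{1/2}$, where $f^{(k)}$ is the $k$-th derivative. *)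

(* Defs.v *)
From mathcomp Require Import all_boot all_order all_algebra.
From mathcomp Require Export complex.
From mathcomp Require Export all_classical all_reals all_analysis.

Set Implicit Arguments.
Unset Strict Implicit.
Unset Printing Implicit Defensive.
Import Order.TTheory GRing.Theory Num.Theory.
Import numFieldNormedType.Exports.

Local Open Scope classical_set_scope.
Local Open Scope complex_scope.
Local Open Scope ring_scope.

Section ClassicalDerivatives.
Context {R : realType}.
Implicit Types (A : set R) (f : R -> R).

(* derive1n is total, so the existence of the derivatives is asserted separately.
   Meant for open A, where it does not depend on the values of f outside A. *)
Definition cont_deriv_on A (n : nat) f :=
  (forall k, (k < n)%N -> {in A, forall x, derivable (derive1n k f) x 1}) /\
  {in A, continuous (derive1n n f)}.

Definition deriv_in_C0 (n : nat) f :=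
  [/\ cont_deriv_on setT n f,
      derive1n n f y @[y --> +oo] --> 0 & derive1n n f y @[y --> -oo] --> 0].

Definition smooth f := forall n, cont_deriv_on setT n f.

End ClassicalDerivatives.

Section Transformations.
Context {R : realType}.
Implicit Types psi : R -> R.

Definition unit_itv : set R := `]- 2^-1, 2^-1[.

(* A fundamental domain of the torus; a function on the torus is represented by
   its values there. *)
Definition torus : set R := `[- 2^-1, 2^-1[.

Definition transf_inv psi : R -> R := 'pinv_(fun=> 0) unit_itv psi.

Definition density psi : R -> R := derive1 (transf_inv psi).

(* A strictly increasing C^1 bijection may have a critical point; regularity of
   the inverse, which the notion includes, is therefore a separate clause. *)
Definition transformation psi :=
  [/\ cont_deriv_on unit_itv 1 psi,
      {in unit_itv &, {homo psi : x y / x < y}},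
      {in unit_itv, forall x, psi (- x) = - psi x},
      psi x @[x --> (- 2^-1)^'+] --> -oo /\
      psi x @[x --> (2^-1 : R)^'-] --> +oo &
      cont_deriv_on setT 1 (transf_inv psi) /\
      {homo transf_inv psi : x y / x < y}].

End Transformations.

Section FunctionSpaces.
Context {R : realType}.
Notation mu := (@lebesgue_measure R).
Implicit Types (D A : set R) (u v : R -> R[i]) (phi : R -> R).

Definition cabs (z : R[i]) : R := ComplexField.Normc.normc z.

Definition Cmeasurable_fun D u :=
  measurable_fun D (fun x => complex.Re (u x)) /\
  measurable_fun D (fun x => complex.Im (u x)).

Definition Cintegral D u : R[i] :=
  (\int[mu]_(x in D) complex.Re (u x)) +i* (\int[mu]_(x in D) complex.Im (u x)).

Definition Cintegrable D u :=
  mu.-integrable D (fun x => (complex.Re (u x))%:E) /\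
  mu.-integrable D (fun x => (complex.Im (u x))%:E).

Definition Clocally_integrable A u :=
  locally_integrable A (fun x => complex.Re (u x)) /\
  locally_integrable A (fun x => complex.Im (u x)).

Definition L2norm D u : \bar R :=
  ('N[mu]_(2%:E)[(fun x => (cabs (u x))%:E) \_ D])%E.

Definition Linfnorm D u : \bar R :=
  ('N[mu]_(+oo)[(fun x => (cabs (u x))%:E) \_ D])%E.

Definition in_L2 D u := Cmeasurable_fun D u /\ (L2norm D u < +oo)%E.

Definition wL2norm (omega : R -> R) u : \bar R :=
  ((\int[mu]_y (cabs (u y) ^+ 2 * omega y)%:E) `^ 2^-1)%E.

Definition in_wL2 (omega : R -> R) u :=
  in_L2 setT u /\ (wL2norm omega u < +oo)%E.

Definition test_fun A phi :=
  smooth phi /\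
  exists K : set R, [/\ compact K, K `<=` A & forall x, ~ K x -> phi x = 0].

Definition torus_test_fun phi := smooth phi /\ forall x, phi (x + 1) = phi x.

Definition weak_deriv A (n : nat) u v :=
  [/\ Clocally_integrable A u, Clocally_integrable A v &
      forall phi, test_fun A phi ->
        Cintegral A (fun x => u x * (derive1n n phi x)%:C) =
        (-1) ^+ n * Cintegral A (fun x => v x * (phi x)%:C)].

(* Periodic test functions need not vanish at the endpoints, so for n > 0 this
   forces u to match across the identification of -1/2 with 1/2. *)
Definition torus_weak_deriv (n : nat) u v :=
  [/\ Cintegrable torus u, Cintegrable torus v &
      forall phi, torus_test_fun phi ->
        Cintegral torus (fun x => u x * (derive1n n phi x)%:C) =
        (-1) ^+ n * Cintegral torus (fun x => v x * (phi x)%:C)].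

(* The derivatives are unique only almost everywhere, so the norm takes as
   argument the family F of (weak) derivatives of orders 0, ..., m. *)
Definition sobolev_norm D (m : nat) (F : nat -> R -> R[i]) : \bar R :=
  ((\sum_(k < m.+1) L2norm D (F k) ^+ 2) `^ 2^-1)%E.

Definition in_Hm_real (m : nat) u :=
  in_L2 setT u /\
  exists F : nat -> R -> R[i],
    (forall k, (k <= m)%N -> weak_deriv setT k u (F k)) /\
    (sobolev_norm setT m F < +oo)%E.

Definition in_Hm_torus (m : nat) u :=
  in_L2 torus u /\
  exists F : nat -> R -> R[i],
    (forall k, (k <= m)%N -> torus_weak_deriv k u (F k)) /\
    (sobolev_norm torus m F < +oo)%E.

Definition transf_weight (psi omega : R -> R) (x : R) : R :=
  Num.sqrt (omega (psi x) * derive1 psi x).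

Definition transformed (psi omega : R -> R) (h : R -> R[i]) (x : R) : R[i] :=
  h (psi x) * (transf_weight psi omega x)%:C.

End FunctionSpaces.

(* Main.v *)
Require Import Defs.
From mathcomp Require Import all_boot all_order all_algebra.
From mathcomp Require Import complex.
From mathcomp Require Import all_classical all_reals all_analysis.
From mathcomp Require Import measurable_realfun ess_sup_inf.
From HB Require Import structures.
From mathcomp Require Import ring lra zify.

(** Formally, the n-th derivative of f = (h o psi) * w, where w is the weight
    sqrt ((omega o psi) * psi'), is a sum of products of some h^(i) o psi, of a
    polynomial in derivatives of psi, and of some w^(j).  Since psi' = r o psi
    with r = 1 / rho, and rho and its derivatives are bounded, differentiating k
    times the factor h o psi yields terms of size at most psi'^(2k-i), with
    i >= 1 as soon as k >= 1.  The exponents max (-1/2, 2k - 3/2) of the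
    hypothesis are those for which such a term times w^(j), j + k = n, is
    bounded by |h^(i) o psi| * sqrt psi'; the substitution y = psi x turns the
    square integral of this bound into the one of h^(i) over the line.  Hence
    all formal derivatives are square integrable ([derivative_sum_L2]).  Below
    the top order the hypothesis for k + 1 leaves a factor 1 / sqrt psi' =
    sqrt (rho o psi), which tends to 0 at the endpoints
    ([derivative_sum_decay]), so integration by parts against a periodic test
    function has no boundary term ([torus_integration_by_parts]).

    The derivatives of h and w are only weak ones, so the product and chain
    rules need a justification.  By the du Bois-Reymond lemma
    ([weak_deriv1_prim]) consecutive weak derivatives have representatives
    which are primitives of one another in the sense of Lebesgue integrals
    ([primitive_on]).  Such pairs are stable under products ([primM]) and, by
    the substitution formula ([ge0_integral_psi]), under composition with psi
    ([prim_comp_psi]); this yields [derivative_sum_prim].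

    The du Bois-Reymond lemma is proved with test functions made of smooth
    steps: the difference of a step at a and a step at b tends to the indicator
    of [a, b], while its derivative is an approximate identity at a minus one
    at b, and approximate identities converge at Lebesgue points. *)

Import Order.TTheory GRing.Theory Num.Theory.
Import numFieldNormedType.Exports.
Local Open Scope classical_set_scope.
Local Open Scope complex_scope.
Local Open Scope ring_scope.

Set Implicit Arguments.
Unset Strict Implicit.
Unset Printing Implicit Defensive.

(** * Primitives of integrable functions *)

Section Primitive.
Context {R : realType}.
Notation mu := (@lebesgue_measure R).
Implicit Types (I D : set R) (u v : R -> R).

(** On an open interval this says that u is locally absolutely continuous with
    derivative v almost everywhere; in integral form no pointwise derivative is
    needed. *)
Definition primitive_on I u v := forall a b, a <= b -> `[a, b] `<=` I ->
  mu.-integrable `[a, b] (EFin \o v) /\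
  u b - u a = \int[mu]_(x in `[a, b]) v x.

Lemma integrableEFinD D u v : measurable D ->
  mu.-integrable D (EFin \o u) -> mu.-integrable D (EFin \o v) ->
  mu.-integrable D (EFin \o (fun x => u x + v x)).
Proof.
move=> mD iu iv.
by rewrite (_ : EFin \o _ = (EFin \o u) \+ (EFin \o v))%E//; exact: integrableD.
Qed.

Lemma integrableEFinZ D c u : measurable D -> mu.-integrable D (EFin \o u) ->
  mu.-integrable D (EFin \o (fun x => c * u x)).
Proof.
move=> mD iu.
by rewrite (_ : EFin \o _ = (fun x => c%:E * (EFin \o u) x))%E//; exact: integrableZl.
Qed.

Lemma Rintegral_split u (a b c : R) : a <= b -> b <= c ->
  mu.-integrable `[a, c] (EFin \o u) ->
  \int[mu]_(x in `[a, c]) u x =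
  \int[mu]_(x in `[a, b]) u x + \int[mu]_(x in `[b, c]) u x.
Proof.
move=> ab bc iu.
have := @Rintegral_itvB R u (BLeft a) (BRight c) b iu.
rewrite !bnd_simp => /(_ ab bc) e.
rewrite -(subrK (\int[mu]_(x in `[a, b]) u x) (\int[mu]_(x in `[a, c]) u x)) e.
rewrite addrC Rintegral_itv_obnd_cbnd//.
by apply: integrableS iu => //; apply: subset_itv; rewrite bnd_simp.
Qed.

Lemma subitv_cc (a b c d : R) : a <= c -> d <= b -> `[c, d] `<=` `[a, b].
Proof. by move=> ac db; apply: subset_itv; rewrite bnd_simp. Qed.

Lemma prim_integrable I u v a b : primitive_on I u v -> `[a, b] `<=` I ->
  mu.-integrable `[a, b] (EFin \o v).
Proof.
move=> uv abI; have [ab|ba] := leP a b; first by have [] := uv a b ab abI.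
by rewrite set_itv_ge ?bnd_simp -?ltNge//; exact: integrable_set0.
Qed.

Lemma prim_within I u v a b : primitive_on I u v -> `[a, b] `<=` I ->
  {within `[a, b], continuous u}.
Proof.
move=> uv abI; have [ab|ba] := leP a b; last first.
  by rewrite set_itv_ge ?bnd_simp -?ltNge//; exact: continuous_subspace0.
have iv := prim_integrable uv abI.
have cont := parameterized_integral_continuous ab iv.
suff : {within `[a, b], continuous
    (fun x => u a + \int[mu]_(t in `[a, x]) v t)}.
  apply: subspace_eq_continuous => x /set_mem/=; rewrite in_itv/= => /andP[ax xb].
  have [|_ e] := uv _ _ ax; last by rewrite /from_subspace -e addrC subrK.
  by apply: subset_trans abI; exact: subitv_cc.
by move=> x; apply: cvgD; [exact: cvg_cst | exact: cont].
Qed.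

Lemma prim_measurable I u v a b : primitive_on I u v -> `[a, b] `<=` I ->
  measurable_fun `[a, b] u.
Proof.
move=> uv abI; apply: subspace_continuous_measurable_fun => //.
exact: prim_within uv abI.
Qed.

Lemma prim_bounded I u v a b : primitive_on I u v -> `[a, b] `<=` I ->
  exists M, forall x, `[a, b]%classic x -> `|u x| <= M.
Proof.
move=> uv abI; have [ab|ba] := leP a b; last first.
  by exists 0 => x; rewrite set_itv_ge// bnd_simp -ltNge.
have cu := prim_within uv abI.
have [c _ hc] := EVT_max ab cu; have [d _ hd] := EVT_min ab cu.
exists (Num.max `|u c| `|u d|) => x xab.
rewrite le_max; have := hc x xab; have := hd x xab => h1 h2.
have [x0|x0] := leP 0 (u x).
  by rewrite ger0_norm// (le_trans h2)// ler_norm.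
rewrite (ltr0_norm x0); apply/orP; right.
by rewrite -(normrN (u d)) (le_trans _ (ler_norm _))// lerN2.
Qed.

Lemma integrableM_bounded D u v M : measurable D ->
  measurable_fun D u -> (forall x, D x -> `|u x| <= M) ->
  mu.-integrable D (EFin \o v) ->
  mu.-integrable D (EFin \o (fun x => u x * v x)).
Proof.
move=> mD mu_ bu iv.
apply: (@le_integrable _ _ _ mu D mD _ (EFin \o (fun x => `|M| * v x))).
- apply/measurable_EFinP; apply: measurable_funM => //.
  by apply/measurable_EFinP; exact: measurable_int iv.
- move=> x Dx /=; rewrite lee_fin !normrM ler_wpM2r//.
  by rewrite normr_id (le_trans (bu x Dx))// ler_norm.
- exact: integrableEFinZ.
Qed.

(** Uniform continuity, from the absolute continuity of the integral of |v|. *)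
Lemma prim_osc I u v a b e : primitive_on I u v -> `[a, b] `<=` I -> 0 < e ->
  exists2 d, 0 < d & forall x y, a <= x -> x <= y -> y <= b -> y - x < d ->
    `|u y - u x| < e.
Proof.
move=> uv abI e0; have iv := prim_integrable uv abI.
have iv' : mu.-integrable setT (EFin \o (v \_ `[a, b])).
  by rewrite -restrict_EFin; apply/integrable_restrict => //=; rewrite setTI.
have [d [d0 hd]] := integral_normr_continuous iv' e0.
exists d => // x y ax xy yb yxd.
have xyab : `[x, y] `<=` `[a, b] by apply: subitv_cc.
have [|ixy ->] := uv x y xy; first exact: subset_trans abI.
apply: le_lt_trans (hd `[x, y]%classic _ _) => //; last first.
  rewrite [ltLHS](_ : _ = (y - x)%:E) ?lte_fin//.
  rewrite /= lebesgue_measure_itv/= lte_fin.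
  by case: ltP => [//|yx]; rewrite (@le_anti _ _ x y) ?subrr// xy yx.
apply: le_trans (le_normr_Rintegral _ ixy) _ => //.
rewrite le_eqVlt; apply/orP; left; apply/eqP.
by apply: eq_Rintegral => t /set_mem txy; rewrite patchE mem_set//; exact: xyab.
Qed.

Lemma prim_continuous I u v : open I -> primitive_on I u v -> {in I, continuous u}.
Proof.
move=> oI uv x /set_mem Ix; have /nbhs_ballP[r /= r0 rI] := open_nbhs_nbhs (conj oI Ix).
have sub : `[x - r / 2, x + r / 2] `<=` I.
  apply: subset_trans rI => y /=; rewrite in_itv/= ball_itv/= in_itv/= => /andP[h1 h2].
  by apply/andP; split; lra.
apply/cvgrPdist_lt => e e0.
have [d d0 hd] := prim_osc uv sub e0.
near=> y.
have yr : `|x - y| < r / 2 by near: y; apply: cvgr_dist_lt => //; lra.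
have yd : `|x - y| < d by near: y; apply: cvgr_dist_lt.
rewrite ltr_distl in yr; rewrite ltr_distl in yd.
case/andP: yr => ? ?; case/andP: yd => ? ?.
have [xy|yx] := leP x y.
  by rewrite distrC; apply: hd; [lra|exact: xy|lra|lra].
by apply: hd; [lra|exact: ltW|lra|lra].
Unshelve. all: by end_near. Qed.

Lemma primD I u1 v1 u2 v2 : primitive_on I u1 v1 -> primitive_on I u2 v2 ->
  primitive_on I (fun x => u1 x + u2 x) (fun x => v1 x + v2 x).
Proof.
move=> p1 p2 a b ab abI; have [i1 e1] := p1 _ _ ab abI; have [i2 e2] := p2 _ _ ab abI.
split; first exact: integrableEFinD.
by rewrite RintegralD// -e1 -e2; ring.
Qed.

Lemma prim_eq I u v v' : primitive_on I u v -> {in I, v =1 v'} ->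
  primitive_on I u v'.
Proof.
move=> uv vv' a b ab abI; have [iv e] := uv a b ab abI; split.
  apply: eq_integrable iv => // x /set_mem xab /=.
  by congr EFin; apply: vv'; rewrite inE; exact: abI.
rewrite e; apply: eq_Rintegral => x /set_mem xab.
by apply: vv'; rewrite inE; exact: abI.
Qed.

Lemma prim_ae_eq I u v v' : measurable I -> measurable_fun I v' ->
  ae_eq mu I v v' -> primitive_on I u v -> primitive_on I u v'.
Proof.
move=> mI mv' vv' uv a b ab abI; have [iv e] := uv a b ab abI.
have aevv' : ae_eq mu `[a, b]%classic (EFin \o v) (EFin \o v').
  apply: filterS vv' => x h /abI Ix /=; congr EFin; exact: h.
have mv'ab : measurable_fun `[a, b]%classic (EFin \o v').
  by apply/measurable_EFinP; apply: measurable_funS mv'.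
split; last first.
  by rewrite e; congr fine; apply: ae_eq_integral => //; exact: measurable_int iv.
apply/integrableP; split => //.
move/integrableP : (iv) => [mv fin_].
rewrite (_ : \int[mu]_(x in _) _ = \int[mu]_(x in `[a, b]) `|(EFin \o v) x|)%E//.
apply: ae_eq_integral => //.
- exact: measurableT_comp.
- exact: measurableT_comp.
- by apply: filterS aevv' => x h /h /= [->].
Qed.

(** Splitting [a, b] into pieces on which u1 and u2 oscillate by at most e, the
    defect of the product formula is additive over the pieces, and on each of
    them it is at most e times the integral of |v1| + |v2|. *)
Lemma primM I u1 v1 u2 v2 : primitive_on I u1 v1 -> primitive_on I u2 v2 ->
  primitive_on I (fun x => u1 x * u2 x) (fun x => v1 x * u2 x + u1 x * v2 x).
Proof.
move=> p1 p2 a b ab abI; set w := fun x => v1 x * u2 x + u1 x * v2 x.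
have i1 := prim_integrable p1 abI; have i2 := prim_integrable p2 abI.
have m1 := prim_measurable p1 abI; have m2 := prim_measurable p2 abI.
have [M1 b1] := prim_bounded p1 abI; have [M2 b2] := prim_bounded p2 abI.
have iu1v2 : mu.-integrable `[a, b] (EFin \o (fun x => u1 x * v2 x)).
  exact: integrableM_bounded b1 i2.
have iv1u2 : mu.-integrable `[a, b] (EFin \o (fun x => v1 x * u2 x)).
  rewrite (_ : (fun x => _) = (fun x => u2 x * v1 x)); last first.
    by apply/funext => x; rewrite mulrC.
  exact: integrableM_bounded b2 i1.
have iw : mu.-integrable `[a, b] (EFin \o w) by exact: integrableEFinD.
split => //; pose V x := `|v1 x| + `|v2 x|.
have iV : mu.-integrable `[a, b] (EFin \o V).
  by apply: integrableEFinD => //; exact: integrable_norm.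
have subI x y f : a <= x -> y <= b -> mu.-integrable `[a, b] (EFin \o f) ->
    mu.-integrable `[x, y] (EFin \o f).
  by move=> ax yb; apply: integrableS => //; exact: subitv_cc.
pose D x y := u1 y * u2 y - u1 x * u2 x - \int[mu]_(t in `[x, y]) w t.
have Dadd x y z : a <= x -> x <= y -> y <= z -> z <= b -> D x z = D x y + D y z.
  move=> ax xy yz zb; rewrite /D (Rintegral_split xy yz); last exact: subI.
  by ring.
have Dsmall e : 0 < e -> exists2 d, 0 < d & forall x y, a <= x -> x <= y -> y <= b ->
    y - x < d -> `|D x y| <= e * \int[mu]_(t in `[x, y]) V t.
  move=> e0; have [d1 d10 h1] := prim_osc p1 abI e0.
  have [d2 d20 h2] := prim_osc p2 abI e0.
  exists (Num.min d1 d2); first by rewrite lt_min d10.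
  move=> x y ax xy yb; rewrite lt_min => /andP[xyd1 xyd2].
  have xyI : `[x, y] `<=` I by apply: subset_trans abI; exact: subitv_cc.
  have [_ e1] := p1 _ _ xy xyI; have [_ e2] := p2 _ _ xy xyI.
  (* With the factors frozen at the endpoints the product formula is exact. *)
  pose q t := v1 t * u2 y + u1 x * v2 t.
  have iq : mu.-integrable `[x, y] (EFin \o q).
    apply: integrableEFinD => //; last by apply: integrableEFinZ => //; exact: subI.
    rewrite (_ : (fun _ => _) = (fun t => u2 y * v1 t)); last first.
      by apply/funext => t; rewrite mulrC.
    by apply: integrableEFinZ => //; exact: subI.
  have -> : D x y = \int[mu]_(t in `[x, y]) (q t - w t).
    rewrite RintegralB//; last exact: subI.
    rewrite /D; congr (_ - _); rewrite RintegralD//; last 2 first.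
    - rewrite (_ : (fun _ => _) = (fun t => u2 y * v1 t)); last first.
        by apply/funext => t; rewrite mulrC.
      by apply: integrableEFinZ => //; exact: subI.
    - by apply: integrableEFinZ => //; exact: subI.
    rewrite RintegralZl ?RintegralZr//; try exact: subI.
    by rewrite -e1 -e2; ring.
  have iqw : mu.-integrable `[x, y] (EFin \o (fun t => q t - w t)).
    rewrite (_ : (fun _ => _) = (fun t => q t + (-1) * w t)); last first.
      by apply/funext => t; rewrite mulN1r.
    by apply: integrableEFinD => //; apply: integrableEFinZ => //; exact: subI.
  apply: le_trans (le_normr_Rintegral _ iqw) _ => //.
  rewrite -RintegralZl//; last exact: subI.
  apply: le_Rintegral => //.
  - exact: integrable_norm.
  - by apply: integrableEFinZ => //; exact: subI.
  move=> t /=; rewrite in_itv/= => /andP[xt ty].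
  have -> : q t - w t = v1 t * (u2 y - u2 t) + (u1 x - u1 t) * v2 t.
    by rewrite /q /w; ring.
  apply: le_trans (ler_normD _ _) _; rewrite /V (mulrDr e) !normrM lerD//.
    by rewrite mulrC ler_wpM2r// ltW// h2//; lra.
  by rewrite ler_wpM2r// distrC ltW// h1//; lra.
have Dle e : 0 < e -> `|D a b| <= e * \int[mu]_(t in `[a, b]) V t.
  move=> e0; have [d d0 hd] := Dsmall e e0.
  suff step n x y : a <= x -> x <= y -> y <= b -> y - x <= n%:R * (d / 2) ->
      `|D x y| <= e * \int[mu]_(t in `[x, y]) V t.
    apply: (step (Num.trunc ((b - a) / (d / 2))).+1) => //.
    have d20 : 0 < d / 2 by lra.
    by rewrite -ler_pdivrMr//; apply/ltW/truncnS_gt.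
  elim: n x y => [|n IH] x y ax xy yb.
    rewrite mul0r => yx; apply: hd => //; lra.
  move=> yxn; pose z := Num.max x (y - d / 2).
  have xz : x <= z by rewrite le_max lexx.
  have zy : z <= y by rewrite ge_max xy/=; lra.
  have yz : y - d / 2 <= z by rewrite le_max lexx orbT.
  rewrite (Dadd x z y)// (Rintegral_split xz zy); last exact: subI.
  rewrite mulrDr; apply: le_trans (ler_normD _ _) _; apply: lerD; last first.
    apply: hd => //; first exact: le_trans xz.
    by lra.
  apply: IH => //; first exact: le_trans yb.
  have yn : (y - d / 2) - x <= n%:R * (d / 2) by rewrite -natr1 in yxn; lra.
  have nd : 0 <= n%:R * (d / 2) by rewrite mulr_ge0//; lra.
  by rewrite lerBlDr /z ge_max; apply/andP; split; lra.
have V0 : 0 <= \int[mu]_(t in `[a, b]) V t.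
  by apply: Rintegral_ge0 => x _; rewrite addr_ge0.
apply/eqP; rewrite -subr_eq0 -/(D a b) -normr_le0.
apply/ler_addgt0Pl => e e0.
rewrite addr0; set K := (\int[mu]_(t in _) V t) in V0 Dle.
have K1 : 0 < K + 1 by lra.
apply: le_trans (Dle (e / (K + 1)) _) _; first by rewrite divr_gt0.
by rewrite mulrAC ler_pdivrMr// ler_wpM2l//; lra.
Qed.

(** Smooth factors enter the product rule through this form of the fundamental
    theorem of calculus. *)
Lemma prim_C1 I u v : open I -> (forall x, I x -> is_derive x 1 u (v x)) ->
  {in I, continuous v} -> primitive_on I u v.
Proof.
move=> oI du cv a b ab abI.
have cvw : {within `[a, b], continuous v}.
  by apply: continuous_in_subspaceT => x /set_mem/abI Ix; apply: cv; rewrite inE.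
split; first by apply: continuous_compact_integrable => //; exact: segment_compact.
have cu x : I x -> {for x, continuous u}.
  by move=> /du dux; apply/differentiable_continuous/derivable1_diffP; exact: ex_derive.
move: ab; rewrite le_eqVlt => /predU1P[->|ab].
  by rewrite subrr set_itv1 Rintegral_set1.
rewrite /Rintegral (@continuous_FTC2 _ v u a b)//.
- split.
  + by move=> x xab; apply: ex_derive; apply: du; apply: abI; exact: subset_itv_oo_cc.
  + by apply: cvg_at_right_filter; apply: cu; apply: abI; rewrite /= in_itv/= lexx ltW.
  + by apply: cvg_at_left_filter; apply: cu; apply: abI; rewrite /= in_itv/= lexx ltW.
- move=> x xab; rewrite derive1E; apply: derive_val; apply: du; apply: abI.
  exact: subset_itv_oo_cc.
Qed.

End Primitive.

(** * Smooth functions *)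

Section RealDerivatives.
Context {R : realType}.
Implicit Types (f g : R -> R) (x a b c s e : R).

Lemma is_deriveDR f g x a b : is_derive x 1 f a -> is_derive x 1 g b ->
  is_derive x 1 (fun y => f y + g y) (a + b).
Proof. by move=> df dg; exact: is_deriveD. Qed.

Lemma is_deriveMR f g x a b : is_derive x 1 f a -> is_derive x 1 g b ->
  is_derive x 1 (fun y => f y * g y) (a * g x + f x * b).
Proof.
move=> df dg; apply: (is_derive_eq (is_deriveM df dg)).
by rewrite addrC mulrC.
Qed.

Lemma is_deriveVR f x a : f x != 0 -> is_derive x 1 f a ->
  is_derive x 1 (fun y => (f y)^-1) (- a * (f x)^-1 * (f x)^-1).
Proof.
move=> fx df; apply: (is_derive_eq (is_deriveV fx df)).
by rewrite expr2 invfM -[_ *: _]/(_ * _); ring.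
Qed.

Lemma is_derive_cstR (c x : R) : is_derive x 1 (fun=> c) 0.
Proof. exact: is_derive_cst. Qed.

Lemma is_derive_affine (a s x : R) : is_derive x 1 (fun y => a + s * y) s.
Proof.
have := is_deriveDR (is_derive_cstR a x)
  (is_deriveMR (is_derive_cstR s x) (is_derive_id x 1)).
by rewrite mul0r add0r mulr1 add0r.
Qed.

Lemma is_derive_compR f g x a b : is_derive (g x) 1 f a -> is_derive x 1 g b ->
  is_derive x 1 (fun y => f (g y)) (a * b).
Proof. exact: is_derive1_comp. Qed.

Lemma is_deriveXR f n x a : is_derive x 1 f a ->
  is_derive x 1 (fun y => f y ^+ n) (n%:R * f x ^+ n.-1 * a).
Proof.
move=> df; elim: n => [|n IH].
  by rewrite !mul0r; exact: is_derive_cstR.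
rewrite (_ : (fun y => f y ^+ n.+1) = (fun y => f y * f y ^+ n)); last first.
  by apply/funext => y; rewrite exprS.
apply: (is_derive_eq (is_deriveMR df IH)).
by case: (n) => [|k] /=; rewrite -?natr1 ?exprS ?expr0; ring.
Qed.

Lemma is_derive_cont f x a : is_derive x 1 f a -> {for x, continuous f}.
Proof.
move=> df; apply/differentiable_continuous/derivable1_diffP; exact: ex_derive.
Qed.

End RealDerivatives.

Section SmoothFunctions.
Context {R : realType}.
Implicit Types (f g : R -> R) (x a b c s e : R).

(** The derivatives of exp(-1/x), continued by 0, are combinations of these
    functions. *)
Definition flat n (x : R) : R := if 0 < x then x^-1 ^+ n * expR (- x^-1) else 0.

Lemma flat_ge0 n x : 0 <= flat n x.
Proof.
rewrite /flat; case: ifP => // x0.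
by rewrite mulr_ge0 ?expR_ge0// exprn_ge0// invr_ge0 ltW.
Qed.

Lemma flat_gt0 n x : 0 < x -> 0 < flat n x.
Proof.
by move=> x0; rewrite /flat x0 mulr_gt0 ?expR_gt0// exprn_gt0// invr_gt0.
Qed.

Lemma flat_le0 n x : x <= 0 -> flat n x = 0.
Proof. by move=> x0; rewrite /flat ltNge x0. Qed.

(** The exponential series gives exp(1/x) >= x^-(n+2) / (n+2)!, which beats the
    pole of order n. *)
Lemma flat_quadratic n x : flat n x <= n.+2`!%:R * x ^+ 2.
Proof.
have [x0|x0] := leP x 0.
  by rewrite flat_le0// mulr_ge0// sqr_ge0.
rewrite /flat x0 expRN ler_pdivrMr ?expR_gt0//.
have xV : 0 <= x^-1 by rewrite invr_ge0 ltW.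
have := expR_ge1Dxn n.+1 xV; set E := expR _ => hE.
have F0 : 0 < n.+2`!%:R :> R by rewrite ltr0n fact_gt0.
have {}hE : x^-1 ^+ n.+2 <= n.+2`!%:R * E.
  by rewrite mulrC -ler_pdivrMr//; apply: le_trans hE; rewrite lerDr.
rewrite mulrAC; apply: le_trans (ler_wpM2r (sqr_ge0 x) hE).
rewrite -addn2 exprD -mulrA -exprMn mulVf ?gt_eqF//.
by rewrite expr1n mulr1.
Qed.

(** At 0 the quadratic bound forces the derivative to vanish. *)
Lemma is_derive_flat n x :
  is_derive x 1 (flat n) (flat n.+2 x - n%:R * flat n.+1 x).
Proof.
have [x0|x0|->] := ltgtP x 0.
- rewrite !flat_le0 ?ltW// mulr0 subr0.
  apply: (near_eq_is_derive _ (is_derive_cstR 0 x)).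
  near=> y; rewrite flat_le0//; apply/ltW; near: y; exact: lt_nbhsl.
- have dV := is_deriveVR (lt0r_neq0 x0) (is_derive_id x 1).
  have dE := @is_derive_compR _ expR (fun y => -1 * y^-1) x _ _
    (is_derive_expR _) (is_deriveMR (is_derive_cstR (-1) x) dV).
  have dE' : is_derive x 1 (fun y => expR (- y^-1)) (expR (- x^-1) * (x^-1 * x^-1)).
    rewrite (_ : (fun y => expR (- y^-1)) = (fun y => expR (-1 * y^-1))); last first.
      by apply/funext => y; rewrite mulN1r.
    rewrite mulN1r in dE; apply: (is_derive_eq dE); ring.
  have d := is_deriveMR (is_deriveXR n dV) dE'.
  have {}d : is_derive x 1 (fun y => y^-1 ^+ n * expR (- y^-1))
      (flat n.+2 x - n%:R * flat n.+1 x).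
    apply: (is_derive_eq d); rewrite /flat x0.
    by case: (n) => [|k] /=; rewrite !exprS ?expr0; ring.
  apply: (near_eq_is_derive _ d).
  by near=> y; rewrite /flat ifT//; near: y; exact: lt_nbhsr.
- rewrite !flat_le0// mulr0 subr0.
  have cvg0 : h^-1 *: (flat n (h *: 1 + 0) - flat n 0) @[h --> 0^'] --> (0 : R).
    apply/cvgrPdist_le => e e0.
    have F0 : 0 < n.+2`!%:R :> R by rewrite ltr0n fact_gt0.
    near=> h.
    have h0 : h != 0 by near: h; exact: nbhs_dnbhs_neq.
    have he : `|h| <= e / n.+2`!%:R.
      near: h; apply: (@dnbhs0_le R R); exact: divr_gt0.
    rewrite sub0r normrN (flat_le0 n (lexx 0)) subr0 addr0.
    rewrite -[h *: 1]/(h * 1) mulr1 normrM normfV.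
    rewrite ler_pdivrMl ?normr_gt0// ger0_norm ?flat_ge0//.
    apply: (le_trans (flat_quadratic n h)).
    rewrite -(real_normK (num_real h)) expr2 mulrCA ler_wpM2l//.
    by rewrite mulrC -ler_pdivlMr.
  split; first by apply/cvg_ex; exists 0.
  by apply/cvg_lim.
Unshelve. all: by end_near. Qed.

(** The algebra of functions generated by the flat functions: closure under
    differentiation is what makes its members smooth. *)
Inductive flat_algebra : (R -> R) -> Prop :=
| FlatGen n a s : flat_algebra (fun x => flat n (a + s * x))
| FlatCst c : flat_algebra (fun=> c)
| FlatAdd f g : flat_algebra f -> flat_algebra g ->
    flat_algebra (fun x => f x + g x)
| FlatMul f g : flat_algebra f -> flat_algebra g ->
    flat_algebra (fun x => f x * g x)
| FlatInv f : (forall x, f x != 0) -> flat_algebra f ->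
    flat_algebra (fun x => (f x)^-1).

Lemma flat_algebra_derive f : flat_algebra f ->
  exists2 g, flat_algebra g & forall x, is_derive x 1 f (g x).
Proof.
elim=> [n a s|c|{}f g _ [f' Af' df] _ [g' Ag' dg]
  |{}f g Af [f' Af' df] Ag [g' Ag' dg]|{}f f0 Af [f' Af' df]].
- exists (fun x => (flat n.+2 (a + s * x) + - n%:R * flat n.+1 (a + s * x)) * s).
    apply: FlatMul; last exact: FlatCst.
    apply: FlatAdd; first exact: FlatGen.
    by apply: FlatMul; [exact: FlatCst|exact: FlatGen].
  move=> x; rewrite mulNr.
  by apply: is_derive_compR; [exact: is_derive_flat|exact: is_derive_affine].
- by exists (fun=> 0); [exact: FlatCst|move=> x; exact: is_derive_cstR].
- by exists (fun x => f' x + g' x); [exact: FlatAdd|move=> x; exact: is_deriveDR].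
- exists (fun x => f' x * g x + f x * g' x); last by move=> x; exact: is_deriveMR.
  by apply: FlatAdd; exact: FlatMul.
- exists (fun x => -1 * f' x * (f x)^-1 * (f x)^-1).
    apply: FlatMul; last exact: FlatInv.
    apply: FlatMul; last exact: FlatInv.
    by apply: FlatMul => //; exact: FlatCst.
  by move=> x; rewrite mulN1r; exact: is_deriveVR.
Qed.

Lemma flat_algebra_affine f (a s : R) : flat_algebra f ->
  flat_algebra (fun x => f (a + s * x)).
Proof.
elim=> [n b t|c|{}f g _ Af _ Ag|{}f g _ Af _ Ag|{}f f0 _ Af].
- rewrite (_ : (fun _ => _) = (fun x => flat n ((b + t * a) + (t * s) * x))).
    exact: FlatGen.
  by apply/funext => x; congr flat; ring.
- exact: FlatCst.
- exact: FlatAdd.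
- exact: FlatMul.
- exact: FlatInv.
Qed.

Lemma flat_algebra_derive1 f : flat_algebra f -> flat_algebra (derive1 f).
Proof.
move=> /flat_algebra_derive[g Ag dg].
by rewrite (_ : derive1 f = g)//; apply/funext => x; rewrite derive1E derive_val.
Qed.

Lemma flat_algebra_is_derive f x : flat_algebra f -> is_derive x 1 f (derive1 f x).
Proof.
move=> /flat_algebra_derive[g Ag dg].
by have -> : derive1 f x = g x by rewrite derive1E derive_val.
Qed.

Lemma flat_algebra_smooth f : flat_algebra f -> smooth f.
Proof.
move=> Af n; have An k : flat_algebra (derive1n k f).
  by elim: k => // k IH; rewrite derive1nS; exact: flat_algebra_derive1.
split => [k _ x _|x _]; last exact: is_derive_cont (flat_algebra_is_derive x (An n)).
by case: (flat_algebra_is_derive x (An k)).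
Qed.

Definition step (x : R) : R := flat 0 (1 + x) / (flat 0 (1 + x) + flat 0 (1 - x)).

(** One of 1 + x and 1 - x is positive. *)
Lemma step_denom_gt0 x : 0 < flat 0 (1 + x) + flat 0 (1 - x).
Proof.
have [x0|x0] := leP x 0.
  by rewrite ltr_wpDl ?flat_ge0// flat_gt0//; lra.
by rewrite ltr_pwDl ?flat_ge0// flat_gt0//; lra.
Qed.

Lemma step_ge1 x : 1 <= x -> step x = 1.
Proof.
move=> x1; have := step_denom_gt0 x; rewrite /step.
rewrite (@flat_le0 0 (1 - x)) ?addr0; last by lra.
by move=> d0; rewrite divff// gt_eqF.
Qed.

Lemma step_leN1 x : x <= -1 -> step x = 0.
Proof. by move=> x1; rewrite /step flat_le0 ?mul0r//; lra. Qed.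

Lemma step_ge0 x : 0 <= step x.
Proof. by rewrite divr_ge0 ?flat_ge0 ?addr_ge0 ?flat_ge0. Qed.

Lemma step_le1 x : step x <= 1.
Proof. by rewrite ler_pdivrMr ?step_denom_gt0// mul1r lerDl flat_ge0. Qed.

Lemma flat_algebra_step : flat_algebra step.
Proof.
have A1 : flat_algebra (fun x => flat 0 (1 + x)).
  rewrite (_ : (fun _ => _) = fun x => flat 0 (1 + 1 * x)); first exact: FlatGen.
  by apply/funext => x; rewrite mul1r.
apply: FlatMul => //; apply: FlatInv => [x|]; first by rewrite gt_eqF ?step_denom_gt0.
apply: FlatAdd => //.
rewrite (_ : (fun _ => _) = fun x => flat 0 (1 + -1 * x)); first exact: FlatGen.
by apply/funext => x; rewrite mulN1r.
Qed.

Lemma derive1_cst_near f (x c : R) : (\forall y \near x, f y = c) -> derive1 f x = 0.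
Proof.
move=> fc; rewrite derive1E (@near_eq_derive _ _ _ f (fun=> c))//.
by rewrite derive_val.
Qed.

Lemma dstep_out x : 1 < `|x| -> derive1 step x = 0.
Proof.
rewrite ltr_normr => /orP[x1|x1].
  apply: (@derive1_cst_near _ _ 1); near=> y; rewrite step_ge1//.
  by apply/ltW; near: y; exact: lt_nbhsr.
apply: (@derive1_cst_near _ _ 0); near=> y; rewrite step_leN1//.
by apply/ltW; near: y; apply: lt_nbhsl; lra.
Unshelve. all: by end_near. Qed.

Lemma dstep_continuous : continuous (derive1 step).
Proof.
move=> x; apply: is_derive_cont.
exact: flat_algebra_is_derive (flat_algebra_derive1 flat_algebra_step).
Qed.

Lemma dstep_bounded : exists M, forall x, `|derive1 step x| <= M.
Proof.
have ab : (-1 : R) <= 1 by lra.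
have cn : {within `[-1, 1], continuous (fun x => `|derive1 step x|)}.
  apply: continuous_subspaceT => x; apply: (@continuous_comp _ _ _ (derive1 step)).
    exact: dstep_continuous.
  exact: norm_continuous.
have [c _ hc] := EVT_max ab cn.
exists `|derive1 step c| => x.
have [x1|x1] := ltP 1 `|x|; first by rewrite dstep_out// normr0.
by apply: hc; rewrite in_itv/= -ler_norml.
Qed.

(** The transition takes place in [a - e, a + e], so that the derivatives form an
    approximate identity at a as e tends to 0. *)
Definition step_at (a e x : R) := step ((x - a) / e).

Lemma flat_algebra_step_at a e : flat_algebra (step_at a e).
Proof.
rewrite (_ : step_at a e = fun x => step (- a / e + e^-1 * x)).
  exact/flat_algebra_affine/flat_algebra_step.
by apply/funext => x; rewrite /step_at; congr step; ring.
Qed.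

Lemma is_derive_step_at a e x :
  is_derive x 1 (step_at a e) (derive1 step ((x - a) / e) / e).
Proof.
rewrite (_ : step_at a e = fun x => step (- a / e + e^-1 * x)); last first.
  by apply/funext => y; rewrite /step_at; congr step; ring.
rewrite (_ : (x - a) / e = - a / e + e^-1 * x); last by ring.
apply: is_derive_compR; last exact: is_derive_affine.
exact: flat_algebra_is_derive flat_algebra_step.
Qed.

Lemma derive1_step_at a e x :
  derive1 (step_at a e) x = derive1 step ((x - a) / e) / e.
Proof. by have dx := is_derive_step_at a e x; rewrite derive1E derive_val. Qed.

Lemma dstep_at_out a e x : 0 < e -> e < `|x - a| -> derive1 (step_at a e) x = 0.
Proof.
move=> e0 ex; rewrite derive1_step_at dstep_out ?mul0r//.
by rewrite normrM normfV (gtr0_norm e0) ltr_pdivlMr// mul1r.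
Qed.

Lemma step_at_ge a e x : 0 < e -> a + e <= x -> step_at a e x = 1.
Proof. by move=> e0 aex; rewrite /step_at step_ge1// ler_pdivlMr// mul1r; lra. Qed.

Lemma step_at_le a e x : 0 < e -> x <= a - e -> step_at a e x = 0.
Proof. by move=> e0 aex; rewrite /step_at step_leN1// ler_pdivrMr// mulN1r; lra. Qed.

End SmoothFunctions.

(** * Weak derivatives and the du Bois-Reymond lemma *)

Section WeakDerivatives.
Context {R : realType}.
Notation mu := (@lebesgue_measure R).
Implicit Types (I D J : set R) (u v phi : R -> R) (a b e : R).

Lemma ae_imply (P Q : R -> Prop) : (forall x, P x -> Q x) ->
  {ae mu, forall x, P x} -> {ae mu, forall x, Q x}.
Proof. by move=> PQ; apply: (@filterS _ _ (ae_filter_ringOfSetsType mu)). Qed.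

Lemma ae_imply2 (P Q S : R -> Prop) : (forall x, P x -> Q x -> S x) ->
  {ae mu, forall x, P x} -> {ae mu, forall x, Q x} -> {ae mu, forall x, S x}.
Proof. by move=> PQS; apply: (@filterS2 _ _ (ae_filter_ringOfSetsType mu)). Qed.

Lemma ae_all (P : R -> Prop) : (forall x, P x) -> {ae mu, forall x, P x}.
Proof. by move=> p; exists set0; split => //= x /=; apply: contra_notP => _; exact: p. Qed.

Lemma Rintegral_support D J u : J `<=` D -> (forall x, ~ J x -> u x = 0) ->
  \int[mu]_(x in D) u x = \int[mu]_(x in J) u x.
Proof.
move=> JD u0; rewrite Rintegral_mkcond [RHS]Rintegral_mkcond.
apply: eq_Rintegral => x _; rewrite !patchE.
have [xJ|xJ] := pselect (J x); first by rewrite !mem_set//; exact: JD.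
by rewrite u0// !if_same.
Qed.

Lemma Rdominated_cvg D (f_ : nat -> R -> R) (f g : R -> R) : measurable D ->
  (forall n, measurable_fun D (f_ n)) -> measurable_fun D f ->
  {ae mu, forall x, D x -> f_ ^~ x @ \oo --> f x} ->
  mu.-integrable D (EFin \o g) ->
  (forall n x, D x -> `|f_ n x| <= g x) ->
  \int[mu]_(x in D) f_ n x @[n --> \oo] --> \int[mu]_(x in D) f x.
Proof.
move=> mD mf_ mf f_f ig f_g.
have [||||i_f _ cv] := @dominated_convergence _ _ R mu D mD
  (fun n => EFin \o f_ n) (EFin \o f) (EFin \o g) _ _ _ ig.
- by move=> n; apply/measurable_EFinP; exact: mf_.
- by apply/measurable_EFinP; exact: mf.
- by apply: ae_imply f_f => x h Dx; apply: cvg_EFin; [exact: nearW|exact: h].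
- by apply: ae_all => x n Dx /=; rewrite lee_fin f_g.
apply: fine_cvg; rewrite fineK; first exact: cv.
exact: integrable_fin_num i_f.
Qed.

Lemma locally_integrable_itv I u a b : locally_integrable I u -> `[a, b] `<=` I ->
  mu.-integrable `[a, b] (EFin \o u).
Proof.
move=> [mu_ oI fin_] abI; apply/integrableP; split.
  by apply/measurable_EFinP; apply: measurable_funS mu_ => //; exact: open_measurable.
exact: (fin_ _ abI (@segment_compact R a b)).
Qed.

(** Averaging against the unit-mass kernel (step_at a e)' costs at most a
    constant times the mean deviation from u a over a ball; the radius 2 * e
    makes the open ball cover the closed interval of integration. *)
Lemma kernel_davg u a e M : 0 < e -> (forall x, `|derive1 step x| <= M) ->
  mu.-integrable `[a - 2 * e, a + 2 * e] (EFin \o u) ->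
  (`|\int[mu]_(x in `[(a - e)%R, (a + e)%R]) (u x * derive1 (step_at a e) x) - u a|%:E
    <= (4 * M)%:E * davg u a (2 * e))%E.
Proof.
move=> e0 bM iu; set J := `[a - e, a + e]%classic.
have mJ : measurable J by exact: measurable_itv.
have aa : a - e <= a + e by lra.
pose s := derive1 (step_at a e).
have cs : continuous s.
  move=> x; apply: is_derive_cont.
  exact: flat_algebra_is_derive (flat_algebra_derive1 (flat_algebra_step_at a e)).
have ms D : measurable D -> measurable_fun D s.
  move=> mD; apply: (measurable_funS measurableT) => //; exact: continuous_measurable_fun.
have bs x : `|s x| <= M / e.
  by rewrite /s derive1_step_at normrM normfV (gtr0_norm e0) ler_pM2r ?invr_gt0.
have iuJ : mu.-integrable J (EFin \o u).
  apply: integrableS iu => //; apply: subset_itv; rewrite bnd_simp; lra.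
have ps : primitive_on setT (step_at a e) s.
  apply: prim_C1; [exact: openT| |by move=> x _; exact: cs].
  by move=> x _; exact: flat_algebra_is_derive (flat_algebra_step_at a e).
have [is1 mass] := ps _ _ aa (@subsetT _ _).
have mass1 : \int[mu]_(x in J) s x = 1.
  by rewrite -mass step_at_ge// step_at_le// subr0.
have iw : mu.-integrable J (EFin \o (fun x => u x - u a)).
  have ic : mu.-integrable J (EFin \o (fun=> - u a)).
    apply: continuous_compact_integrable; first exact: segment_compact.
    by apply: continuous_subspaceT => x; exact: cst_continuous.
  exact: integrableEFinD.
have iws : mu.-integrable J (EFin \o (fun x => s x * (u x - u a))).
  by apply: (@integrableM_bounded _ _ _ _ (M / e)) => //; exact: ms.
have ius : mu.-integrable J (EFin \o (fun x => s x * u x)).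
  by apply: (@integrableM_bounded _ _ _ _ (M / e)) => //; exact: ms.
have -> : \int[mu]_(x in J) (u x * s x) - u a = \int[mu]_(x in J) (s x * (u x - u a)).
  rewrite -[in LHS](mulr1 (u a)) -mass1 -RintegralZl// -RintegralB//.
  - by apply: eq_Rintegral => x _; ring.
  - by rewrite (_ : (fun x => u x * s x) = (fun x => s x * u x))//;
      apply/funext => x; rewrite mulrC.
  - exact: integrableEFinZ.
apply: (@le_trans _ _ ((M / e)%:E * \int[mu]_(x in J) `|(u x - u a)%:E|)%E).
  have iN := integrable_norm iw.
  apply: (@le_trans _ _ (\int[mu]_(x in J) (M / e * `|u x - u a|))%:E).
    rewrite lee_fin; apply: le_trans (le_normr_Rintegral _ iws) _ => //.
    apply: le_Rintegral => //.
    - exact: integrable_norm.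
    - exact: integrableEFinZ.
    - by move=> x _; rewrite normrM ler_wpM2r.
  rewrite RintegralZl// EFinM /Rintegral fineK//.
  exact: integrable_fin_num iN.
have M0 : 0 <= M by apply: le_trans (bM 0).
have e20 : 0 <= 2 * e by lra.
have -> : (4 * M)%:E = ((M / e)%:E * (4 * e)%:E)%E.
  by rewrite -EFinM; congr EFin; field; rewrite gt_eqF.
rewrite -muleA; apply: lee_wpmul2l; first by rewrite lee_fin divr_ge0// ltW.
rewrite /davg /iavg lebesgue_measure_ball// muleA.
rewrite inver gt_eqF ?pmulrn_lgt0//; last by lra.
rewrite -EFinM (_ : 4 * e / _ = 1) ?mul1e; last by field; rewrite gt_eqF.
apply: ge0_subset_integral => //=.
- exact: measurable_ball.
- do 2 apply: measurableT_comp => //; apply: measurable_funB => //.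
  have /measurable_int/measurable_EFinP := iu; apply: measurable_funS => //.
  by rewrite ball_itv; apply: subset_itv; rewrite bnd_simp.
- by rewrite ball_itv; apply: subset_itv; rewrite bnd_simp; lra.
Qed.

Lemma kernel_cvg u a r : 0 < r -> lebesgue_pt u a ->
  mu.-integrable `[a - 2 * r, a + 2 * r] (EFin \o u) ->
  \int[mu]_(x in `[(a - r / n.+1%:R)%R, (a + r / n.+1%:R)%R])
    (u x * derive1 (step_at a (r / n.+1%:R)) x) @[n --> \oo] --> u a.
Proof.
move=> r0 ua iu; have [M bM] := @dstep_bounded R.
pose e n := r / n.+1%:R; have e0 n : 0 < e n by rewrite divr_gt0.
have er n : e n <= r by rewrite ler_pdivrMr// ler_peMr ?ler1n// ltW.
have cve : 2 * e n @[n --> \oo] --> (0 : R).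
  rewrite -(mulr0 (2 * r)) (_ : (fun _ => _) = (fun n => (2 * r) * n.+1%:R^-1)).
    by apply: cvgM; [exact: cvg_cst|exact: cvg_harmonic].
  by apply/funext => n; rewrite mulrA.
have cvd : ((4 * M)%:E * davg u a (2 * e n) @[n --> \oo] --> 0%:E)%E.
  rewrite -[X in _ --> X](mule0 (4 * M)%:E); apply: cvgeM => //; first exact: cvg_cst.
  by move/cvge_at_rightP : ua; apply; split => // n; rewrite mulr_gt0.
apply/cvgrPdist_le => d d0.
have /fine_cvgP[finN cvN] := cvd.
move/cvgrPdist_le : cvN => /(_ d d0) cvN.
near=> n.
have fn : ((4 * M)%:E * davg u a (2 * e n))%E \is a fin_num by near: n.
have hn : `|0 - fine ((4 * M)%:E * davg u a (2 * e n))%E| <= d by near: n.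
rewrite distrC -lee_fin; apply: le_trans (kernel_davg (e0 n) bM _) _.
  by apply: integrableS iu => //; apply: subset_itv; rewrite bnd_simp;
    have := er n; lra.
rewrite -(fineK fn) lee_fin; apply: le_trans hn.
by rewrite sub0r normrN ler_norm.
Unshelve. all: by end_near. Qed.

(** Being a Lebesgue point is local: countably many truncations of u to intervals
    with rational endpoints reach every point of I. *)
Lemma lebesgue_pt_ae I u : open I -> locally_integrable I u ->
  {ae mu, forall x, I x -> lebesgue_pt u x}.
Proof.
move=> oI lu.
pose ab n : R * R := if @unpickle (rat * rat)%type n is Some pq
  then (ratr pq.1, ratr pq.2) else (0, 0).
have : {ae mu, forall x n, `[(ab n).1, (ab n).2] `<=` I ->
    lebesgue_pt (u \_ `[(ab n).1, (ab n).2]) x}.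
  apply: ae_foralln => n.
  have [abI|abI] := pselect (`[(ab n).1, (ab n).2] `<=` I); last exact: ae_all.
  have /lebesgue_differentiation : locally_integrable setT (u \_ `[(ab n).1, (ab n).2]).
    by apply: integrable_locally_restrict => //; exact: locally_integrable_itv abI.
  by apply: ae_imply => x hx _.
apply: ae_imply => x hx Ix.
have /nbhs_ballP[r /= r0 rI] := open_nbhs_nbhs (conj oI Ix).
have [p /[!in_itv]/= /andP[p1 p2]] : exists p : rat, ratr p \in `]x - r, x[.
  by apply: rat_in_itvoo; rewrite ltrBlDr ltrDl.
have [q /[!in_itv]/= /andP[q1 q2]] : exists q : rat, ratr q \in `]x, x + r[.
  by apply: rat_in_itvoo; rewrite ltrDl.
have abn : ab (pickle (p, q)) = (ratr p, ratr q) by rewrite /ab pickleK.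
have := hx (pickle (p, q)); rewrite abn /= => /(_ _) h.
have {}h : lebesgue_pt (u \_ `[ratr p, ratr q]) x.
  apply: h; apply: subset_trans rI; rewrite ball_itv.
  by apply: subset_itv; rewrite bnd_simp.
apply: cvg_trans h; apply: near_eq_cvg.
have := @near_davg R u (BLeft (ratr p)) x (ratr q) q1.
by rewrite lte_fin => /(_ p2); apply: filterS => s /esym.
Qed.

Definition weak_deriv_real I n u v :=
  [/\ locally_integrable I u, locally_integrable I v &
      forall phi, test_fun I phi ->
        \int[mu]_(x in I) (u x * derive1n n phi x) =
        (-1) ^+ n * \int[mu]_(x in I) (v x * phi x)].

Lemma test_fun_derive I phi : test_fun I phi -> test_fun I (derive1 phi).
Proof.
move=> [sphi [K [cK KI phi0]]]; split.
  move=> n; have [d1 d2] := sphi n.+1; split=> [k kn x xA|].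
    by rewrite -derive1Sn; apply: d1.
  by rewrite -derive1Sn.
exists K; split => // x nKx; apply: (@derive1_cst_near _ _ _ 0).
have oK : open (~` K) by apply/closed_openC; exact: compact_closed.
have := open_nbhs_nbhs (conj oK nKx); apply: filterS => y; exact: phi0.
Qed.

(** Testing against derivatives of test functions turns consecutive derivatives
    of one function into derivatives of each other. *)
Lemma weak_deriv_step I n u v w : weak_deriv_real I n u v ->
  weak_deriv_real I n.+1 u w -> weak_deriv_real I 1 v w.
Proof.
move=> [_ lv uv] [_ lw uw]; split => // phi tphi.
have := uw phi tphi; rewrite derive1Sn uv; last exact: test_fun_derive.
rewrite derive1n1 exprS mulrAC [RHS]mulrC expr1 => e.
have : (-1) ^+ n * ((-1) ^+ n * \int[mu]_(x in I) (v x * derive1 phi x)) =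
       (-1) ^+ n * ((-1) ^+ n * (-1 * \int[mu]_(x in I) (w x * phi x))).
  by rewrite e; ring.
by rewrite !mulrA -!expr2 !sqrr_sign !mul1r.
Qed.

Lemma flat_algebra_test I J phi : flat_algebra phi -> compact J -> J `<=` I ->
  (forall x, ~ J x -> phi x = 0) -> test_fun I phi.
Proof.
move=> Aphi cJ JI phi0; split; first exact: flat_algebra_smooth.
by exists J.
Qed.

Lemma itv_room I a : open I -> I a ->
  exists2 r, 0 < r & `[a - 2 * r, a + 2 * r] `<=` I.
Proof.
move=> oI Ia; have /nbhs_ballP[r /= r0 rI] := open_nbhs_nbhs (conj oI Ia).
exists (r / 4); first by rewrite divr_gt0.
apply: subset_trans rI; rewrite ball_itv.
by apply: subset_itv; rewrite bnd_simp; lra.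
Qed.

(** The test functions (step_at a e)' are approximate identities at a, and these
    recover the value of a function at its Lebesgue points. *)
Lemma weak_deriv0_ae I u v : open I -> weak_deriv_real I 0 u v -> ae_eq mu I u v.
Proof.
move=> oI [lu lv uv].
have := lebesgue_pt_ae oI lu; have := lebesgue_pt_ae oI lv.
apply: ae_imply2 => a lva lua Ia.
have [r r0 rI] := itv_room oI Ia.
have iu := locally_integrable_itv lu rI; have iv := locally_integrable_itv lv rI.
have := kernel_cvg r0 (lua Ia) iu; have := kernel_cvg r0 (lva Ia) iv => cv cu.
apply: (cvg_unique _ cu); first exact: Rhausdorff.
apply: cvg_trans cv; apply: near_eq_cvg; apply: nearW => n /=.
set e := r / n.+1%:R; have e0 : 0 < e by rewrite divr_gt0.
have er : e <= r by rewrite ler_pdivrMr// ler_peMr ?ler1n// ltW.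
have JI : `[a - e, a + e] `<=` I.
  by apply: subset_trans rI; apply: subset_itv; rewrite bnd_simp; lra.
have out x : ~ `[a - e, a + e]%classic x -> derive1 (step_at a e) x = 0.
  move=> xJ; apply: dstep_at_out => //; rewrite ltNge; apply/negP => h; apply: xJ.
  by rewrite /= in_itv/= -ler_distl.
have := uv (derive1 (step_at a e)); rewrite expr0 mul1r derive1n0.
rewrite (Rintegral_support JI); last by move=> x /out ->; rewrite mulr0.
rewrite (Rintegral_support JI); last by move=> x /out ->; rewrite mulr0.
move=> <- //; apply: (flat_algebra_test _ (@segment_compact R (a - e) (a + e))) => //.
exact: flat_algebra_derive1 (flat_algebra_step_at a e).
Qed.

End WeakDerivatives.

Section DuBoisReymond.
Context {R : realType}.
Notation mu := (@lebesgue_measure R).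
Implicit Types (I D J : set R) (u v phi : R -> R) (a b e : R).

Lemma step_difference a b e x : 0 < e -> a < b -> e < `|x - a| -> e < `|x - b| ->
  step_at a e x + -1 * step_at b e x = if a <= x <= b then 1 else 0.
Proof.
move=> e0 ab ea eb.
have [x1|x1] := ltP x a; rewrite /=.
  rewrite ltr0_norm ?subr_lt0// in ea.
  by rewrite !step_at_le ?mulr0 ?addr0//; lra.
rewrite ger0_norm ?subr_ge0// in ea.
have [x2|x2] := ltP b x; rewrite /=.
  rewrite gtr0_norm ?subr_gt0// in eb.
  by rewrite !step_at_ge ?mulr1 ?subrr//; lra.
rewrite ler0_norm ?subr_le0// in eb.
by rewrite step_at_ge ?step_at_le ?mulr0 ?addr0//; lra.
Qed.

(** The test functions step_at a e - step_at b e tend to the indicator of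
    [a, b], while their derivatives concentrate at a and b. *)
Lemma weak_deriv1_increment I u v a b : open I -> `[a, b] `<=` I -> a < b ->
  weak_deriv_real I 1 u v -> lebesgue_pt u a -> lebesgue_pt u b ->
  u b - u a = \int[mu]_(x in `[a, b]) v x.
Proof.
move=> oI abI ab [lu lv uv] lua lub.
have [|r1 r10 r1I] := @itv_room R I a oI.
  by apply: abI; rewrite /= in_itv/= lexx ltW.
have [|r2 r20 r2I] := @itv_room R I b oI.
  by apply: abI; rewrite /= in_itv/= lexx ltW.
pose r := Num.min r1 r2.
have r0 : 0 < r by rewrite lt_min r10.
have rr1 : r <= r1 by rewrite ge_min lexx.
have rr2 : r <= r2 by rewrite ge_min lexx orbT.
pose L : set R := `[a - 2 * r, b + 2 * r]%classic.
have mL : measurable L by exact: measurable_itv.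
have LI : L `<=` I.
  move=> x; rewrite /L/= in_itv/= => /andP[x1 x2].
  have [xa|xa] := ltP x a; first by apply: r1I; rewrite /= in_itv/=; apply/andP; split; lra.
  have [bx|bx] := ltP b x; first by apply: r2I; rewrite /= in_itv/=; apply/andP; split; lra.
  by apply: abI; rewrite /= in_itv/= xa bx.
have iu : mu.-integrable L (EFin \o u) := locally_integrable_itv lu LI.
have iv : mu.-integrable L (EFin \o v) := locally_integrable_itv lv LI.
pose e n := r / n.+1%:R; have e0 n : 0 < e n by rewrite divr_gt0.
have er n : e n <= r by rewrite ler_pdivrMr// ler_peMr ?ler1n// ltW.
pose phi n x := step_at a (e n) x + -1 * step_at b (e n) x.
have Aphi n : flat_algebra (phi n).
  apply: FlatAdd; first exact: flat_algebra_step_at.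
  by apply: FlatMul; [exact: FlatCst|exact: flat_algebra_step_at].
have phi_out n x : ~ L x -> phi n x = 0.
  have := er n => ern; have := e0 n => e0n.
  move=> Lx; have [xa|xa] := leP x (a - e n).
    by rewrite /phi !step_at_le//; [ring|lra].
  have [bx|bx] := leP (b + e n) x.
    by rewrite /phi !step_at_ge//; [ring|lra].
  by exfalso; apply: Lx; rewrite /L/= in_itv/=; apply/andP; split; lra.
have dphi n x : derive1 (phi n) x =
    derive1 (step_at a (e n)) x - derive1 (step_at b (e n)) x.
  have da := is_derive_step_at a (e n) x; have db := is_derive_step_at b (e n) x.
  have d := is_deriveDR da (is_deriveMR (is_derive_cstR (-1) x) db).
  rewrite !derive1_step_at derive1E; have [_ ->] := d.
  by rewrite mul0r add0r mulN1r.
have test n : test_fun I (phi n).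
  by apply: (flat_algebra_test (Aphi n) (@segment_compact R _ _) LI) => x; exact: phi_out.
have ker c n : a <= c -> c <= b ->
    let J := `[c - e n, c + e n]%classic in
    [/\ J `<=` L,
       mu.-integrable L (EFin \o (fun x => u x * derive1 (step_at c (e n)) x)) &
       \int[mu]_(x in L) (u x * derive1 (step_at c (e n)) x) =
       \int[mu]_(x in J) (u x * derive1 (step_at c (e n)) x)].
  move=> ac cb J; have ern := er n; have e0n := e0 n.
  have JL : J `<=` L by apply: subset_itv; rewrite bnd_simp; lra.
  split => //.
    rewrite (_ : (fun _ => _) = (fun x => derive1 (step_at c (e n)) x * u x)); last first.
      by apply/funext => x; rewrite mulrC.
    have [M bM] := @dstep_bounded R.
    apply: (@integrableM_bounded R _ _ _ (M / e n)) => //.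
      apply: (measurable_funS measurableT) => //; apply: continuous_measurable_fun => x.
      apply: is_derive_cont.
      exact: flat_algebra_is_derive (flat_algebra_derive1 (flat_algebra_step_at c _)).
    by move=> x _; rewrite derive1_step_at normrM normfV (gtr0_norm e0n) ler_pM2r ?invr_gt0.
  apply: Rintegral_support => // x xJ.
  rewrite dstep_at_out ?mulr0//; rewrite ltNge; apply/negP => h; apply: xJ.
  by rewrite /J/= in_itv/= -ler_distl.
have eqn n : \int[mu]_(x in `[(a - e n)%R, (a + e n)%R]) (u x * derive1 (step_at a (e n)) x)
   - \int[mu]_(x in `[(b - e n)%R, (b + e n)%R]) (u x * derive1 (step_at b (e n)) x)
   = - \int[mu]_(x in L) (v x * phi n x).
  have [_ ia <-] := ker a n (lexx a) (ltW ab).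
  have [_ ib <-] := ker b n (ltW ab) (lexx b).
  rewrite -(RintegralB _ ia ib)//.
  have := uv (phi n) (test n); rewrite derive1n1 expr1 mulN1r.
  rewrite (Rintegral_support LI); last first.
    move=> x Lx; rewrite (_ : derive1 (phi n) x = 0) ?mulr0//.
    apply: (@derive1_cst_near _ _ _ 0).
    have oL : open (~` L) by apply/closed_openC; exact: itv_closed.
    by have := open_nbhs_nbhs (conj oL Lx); apply: filterS => y; exact: phi_out.
  rewrite (Rintegral_support LI) => [<-|x /phi_out ->]; last by rewrite mulr0.
  by apply: eq_Rintegral => x _; rewrite dphi mulrBr.
have cva : \int[mu]_(x in `[(a - e n)%R, (a + e n)%R])
    (u x * derive1 (step_at a (e n)) x) @[n --> \oo] --> u a.
  apply: (kernel_cvg r0 lua); apply: integrableS iu => //.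
  by apply: subset_itv; rewrite bnd_simp; lra.
have cvb : \int[mu]_(x in `[(b - e n)%R, (b + e n)%R])
    (u x * derive1 (step_at b (e n)) x) @[n --> \oo] --> u b.
  apply: (kernel_cvg r0 lub); apply: integrableS iu => //.
  by apply: subset_itv; rewrite bnd_simp; lra.
have cvv : \int[mu]_(x in L) (v x * phi n x) @[n --> \oo] -->
    \int[mu]_(x in L) ((v \_ `[a, b]) x).
  have mv : measurable_fun L v by have /measurable_int/measurable_EFinP := iv.
  apply: (@Rdominated_cvg R L _ _ (fun x => `|v x|)) => //.
  - move=> n; apply: measurable_funM => //.
    apply: (measurable_funS measurableT) => //; apply: continuous_measurable_fun => x.
    exact: is_derive_cont (flat_algebra_is_derive x (Aphi n)).
  - have mab : measurable `[a, b]%classic by exact: measurable_itv.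
    apply: ((measurable_restrict v mab mL).1 _).
    by apply: measurable_funS mv => // x [].
  - exists ([set a] `|` [set b]); split => //.
    + exact: measurableU.
    + by rewrite measureU0//= ?lebesgue_measure_set1.
    move=> x /= /not_implyP[Lx]; apply: contra_notP => /not_orP[/eqP xa /eqP xb].
    apply: cvg_near_cst.
    have cve : e n @[n --> \oo] --> (0 : R).
      rewrite -(mulr0 r); apply: cvgM; [exact: cvg_cst|exact: cvg_harmonic].
    have da : 0 < `|x - a| by rewrite normr_gt0 subr_eq0.
    have db : 0 < `|x - b| by rewrite normr_gt0 subr_eq0.
    near=> n.
    have ea : e n < `|x - a|.
      near: n; move/cvgrPdist_lt : cve => /(_ _ da); apply: filterS => n.
      by rewrite sub0r normrN => /(le_lt_trans (ler_norm _)).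
    have eb : e n < `|x - b|.
      near: n; move/cvgrPdist_lt : cve => /(_ _ db); apply: filterS => n.
      by rewrite sub0r normrN => /(le_lt_trans (ler_norm _)).
    rewrite /phi step_difference// patchE.
    have -> : (x \in `[a, b]%classic) = (a <= x <= b) by apply/idP/idP; rewrite inE/= in_itv.
    by case: ifP; rewrite ?mulr1 ?mulr0.
  - exact: integrable_norm.
  - move=> n x _; rewrite normrM ler_piMr//.
    have := step_ge0 ((x - a) / e n); have := step_le1 ((x - a) / e n).
    have := step_ge0 ((x - b) / e n); have := step_le1 ((x - b) / e n).
    rewrite /phi /step_at => *; rewrite ler_norml; apply/andP; split; lra.
have cvn : (- \int[mu]_(x in L) (v x * phi n x)) @[n --> \oo] --> u a - u b.
  by apply: cvg_trans (cvgB cva cvb); apply: near_eq_cvg; apply: nearW => n; exact: eqn.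
have : u a - u b = - \int[mu]_(x in L) ((v \_ `[a, b]) x).
  by apply: (cvg_unique _ cvn); [exact: Rhausdorff|exact: (cvgN cvv)].
rewrite -Rintegral_mkcondr (_ : L `&` `[a, b] = `[a, b]%classic); last first.
  apply/seteqP; split => [x []//|x xab]; split => //.
  by move: xab; apply: subset_itv; rewrite bnd_simp; lra.
by move=> h; rewrite -(opprK (\int[mu]_(x in _) _)) -h; ring.
Unshelve. all: by end_near. Qed.

End DuBoisReymond.

Section Representatives.
Context {R : realType}.
Notation mu := (@lebesgue_measure R).
Implicit Types (I D J : set R) (u v phi : R -> R) (a b e : R).

Definition oriented_integral (v : R -> R) (c x : R) : R :=
  if c <= x then \int[mu]_(t in `[c, x]) v t else - \int[mu]_(t in `[x, c]) v t.

Lemma prim_oriented_integral I v c k : is_interval I -> I c ->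
  (forall a b, `[a, b] `<=` I -> mu.-integrable `[a, b] (EFin \o v)) ->
  primitive_on I (fun x => k + oriented_integral v c x) v.
Proof.
move=> itvI Ic iv a b ab abI; split; first exact: iv.
have Ia : I a by apply: abI; rewrite /= in_itv/= lexx.
have Ib : I b by apply: abI; rewrite /= in_itv/= lexx andbT.
have sub x y : I x -> I y -> `[x, y] `<=` I.
  by move=> Ix Iy z; rewrite /= in_itv/= => xzy; exact: (itvI x y).
rewrite /oriented_integral opprD addrACA subrr add0r.
have [ca|ac] := leP c a.
  rewrite (le_trans ca ab) (Rintegral_split ca ab); first by ring.
  exact/iv/sub.
have [cb|bc] := leP c b.
  rewrite (Rintegral_split (ltW ac) cb); first by ring.
  exact/iv/sub.
rewrite (Rintegral_split ab (ltW bc)); first by ring.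
exact/iv/sub.
Qed.

Lemma open_ae_point I (P : R -> Prop) : open I -> I !=set0 ->
  {ae mu, forall x, I x -> P x} -> exists2 x, I x & P x.
Proof.
move=> oI [c Ic] aeP; apply: contrapT => noP.
have /nbhs_ballP[r /= r0 rI] := open_nbhs_nbhs (conj oI Ic).
case: aeP => N [mN muN sN].
have : (mu (ball c r) <= mu N)%E.
  apply: le_measure; rewrite ?inE//; first exact: measurable_ball.
  move=> x /rI Ix; apply: sN => /= /(_ Ix) Px; apply: noP; by exists x.
rewrite muN lebesgue_measure_ball ?(ltW r0)// lee_fin leNgt => /negP; apply.
by rewrite pmulrn_lgt0.
Qed.

(** The du Bois-Reymond lemma: a function with a weak derivative is almost
    everywhere equal to a primitive of it. *)
Lemma weak_deriv1_prim I u v : open I -> is_interval I -> I !=set0 ->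
  weak_deriv_real I 1 u v -> exists2 w, primitive_on I w v & ae_eq mu I u w.
Proof.
move=> oI itvI I0 uv; have [lu lv _] := uv.
have aeL := lebesgue_pt_ae oI lu.
have [c Ic Lc] := open_ae_point oI I0 aeL.
exists (fun x => u c + oriented_integral v c x).
  apply: prim_oriented_integral => // a b abI; exact: locally_integrable_itv abI.
apply: ae_imply aeL => x + Ix => /(_ Ix) Lx.
have sub y z : I y -> I z -> `[y, z] `<=` I.
  by move=> Iy Iz t; rewrite /= in_itv/= => yzt; exact: (itvI y z).
rewrite /oriented_integral; have [cx|xc|->] := ltgtP c x.
- rewrite -(weak_deriv1_increment oI _ cx uv)//; first by ring.
  exact: sub.
- rewrite -(weak_deriv1_increment oI _ xc uv)//; first by ring.
  exact: sub.
- by rewrite set_itv1 Rintegral_set1 addr0.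
Qed.

(** Consecutive weak derivatives have representatives that are primitives of
    one another; only the top one fails to be continuous. *)
Lemma weak_deriv_representatives I m (F : nat -> R -> R) : open I -> is_interval I ->
  I !=set0 -> (forall k, (k <= m)%N -> weak_deriv_real I k (F 0%N) (F k)) ->
  exists A : nat -> R -> R,
    [/\ forall k, (k <= m)%N -> ae_eq mu I (F k) (A k),
        forall k, (k <= m)%N -> measurable_fun I (A k) &
        forall k, (k < m)%N -> primitive_on I (A k) (A k.+1)].
Proof.
move=> oI itvI I0 dF; have mI := open_measurable oI.
have ex k : exists w, (k <= m)%N ->
    [/\ ae_eq mu I (F k) w, measurable_fun I w & (k < m)%N -> primitive_on I w (F k.+1)].
  have [km|mk] := ltnP k m.
    have [w pw aew] := weak_deriv1_prim oI itvI I0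
      (weak_deriv_step (dF k (ltnW km)) (dF k.+1 km)).
    exists w => _; split => //; apply: open_continuous_measurable_fun => //.
    exact: prim_continuous pw.
  exists (F k) => km; split => //.
  - exact: ae_all.
  - by have [_ [] ] := dF k km.
have [A hA] := choice ex; exists A; split => k km.
- by have [] := hA k km.
- by have [] := hA k km.
- have [_ _ /(_ km)] := hA k (ltnW km).
  by have [aek mk _] := hA k.+1 km; exact: prim_ae_eq.
Qed.

End Representatives.

(** * Integration by substitution *)

Section ChangeOfVariables.
Context {R : realType}.
Notation mu := (@lebesgue_measure R).
Local Open Scope ereal_scope.
Import HBNNSimple.

(* The Borel structure over which the Lebesgue measure is declared. *)
Let T := measurableTypeR R.
Variables (D : set T) (psi : T -> T) (p : T -> R).
Hypothesis mD : measurable D.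
Hypothesis mpsi : measurable_fun D psi.
Hypothesis mp : measurable_fun D p.
Hypothesis p0 : forall x, D x -> (0 <= p x)%R.
Hypothesis massE : forall a b, (a < b)%R ->
  \int[mu]_(x in D `&` psi @^-1` `]a, b]) (p x)%:E = (b - a)%:E.

Let psiD : T -> T := psi \_ D.
Let pD : T -> \bar R := (EFin \o p) \_ D.

Let mpsiD : measurable_fun setT psiD.
Proof. exact: ((measurable_restrictT psi mD).1 mpsi). Qed.

Let mpD : measurable_fun setT pD.
Proof.
by apply: ((measurable_restrictT (EFin \o p) mD).1 _); apply/measurable_EFinP.
Qed.

Let pD0 x : 0 <= pD x.
Proof. by rewrite /pD patchE; case: ifPn => // /set_mem/p0; rewrite lee_fin. Qed.

Let nu (A : set T) : \bar R := \int[mu]_(x in psiD @^-1` A) pD x.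

Let nuE (A : set T) : nu A = \int[mu]_(x in D `&` psi @^-1` A) (p x)%:E.
Proof.
rewrite /nu /pD -integral_mkcondr; congr (integral _ _ _).
by apply/seteqP; split=> x [] h1 h2; split => //; move: h1 h2; rewrite /psiD /preimage/=
  patchE; case: ifPn => // /negP h h1 h2; exfalso; apply: h; rewrite inE.
Qed.

Let mpre (A : set T) : measurable A -> measurable (psiD @^-1` A).
Proof. by move=> mA; rewrite -(setTI (_ @^-1` _)); exact: mpsiD. Qed.

Let nu0 : nu set0 = 0.
Proof. by rewrite /nu preimage_set0 integral_set0. Qed.

Let nu_ge0 A : 0 <= nu A.
Proof. by apply: integral_ge0 => x _. Qed.

Let nu_sigma : semi_sigma_additive nu.
Proof.
move=> F mF tF mUF; rewrite /nu preimage_bigcup.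
apply: semi_sigma_additive_nng_induced => //.
- by move=> n; apply: mpre; exact: mF.
- apply/trivIsetP => i j _ _ ij; rewrite -preimage_setI.
  by have /trivIsetP/(_ i j I I ij) -> := tF; rewrite preimage_set0.
- by rewrite -preimage_bigcup; exact: mpre.
Qed.

HB.instance Definition _ := isMeasure.Build _ T R nu nu0 nu_ge0 nu_sigma.

(** Both sides are measures in A that agree on the intervals ]a, b]. *)
Lemma lebesgue_measure_substitution (A : set T) : measurable A ->
  \int[mu]_(x in D `&` psi @^-1` A) (p x)%:E = mu A.
Proof.
move=> mA; rewrite -nuE; apply/esym.
apply: (@lebesgue_measure_unique R nu) => // _ [[a b] _ <-] /=.
rewrite nuE lebesgue_measure_itv/= lte_fin; case: ltP => ab.
  by rewrite massE// EFinB.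
by rewrite set_itv_ge ?bnd_simp -?leNgt// preimage_set0 setI0 integral_set0.
Qed.

Let subst_simple (s : {nnsfun T >-> R}) :
  \int[mu]_(x in D) (s (psi x) * p x)%:E = \int[mu]_y (s y)%:E.
Proof.
rewrite integralT_nnsfun sintegralE.
pose f r x : \bar R := r%:E * ((\1_(s @^-1` [set r]) (psi x))%:E * (p x)%:E).
have f0 r x : D x -> 0 <= f r x.
  move=> Dx; rewrite /f muleA; apply: mule_ge0; last by rewrite lee_fin p0.
  exact: nnfun_muleindic_ge0.
have ms r : measurable (s @^-1` [set r]) by exact: measurable_sfunP.
have mind r : measurable_fun D (fun x => (\1_(s @^-1` [set r]) (psi x))%:E * (p x)%:E).
  apply: emeasurable_funM; last exact/measurable_EFinP.
  have mi : measurable_fun setT (\1_(s @^-1` [set r]) : T -> R) by exact: measurable_indic.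
  apply/measurable_EFinP; exact: (measurableT_comp mi mpsi).
have mf r : measurable_fun D (f r) by exact: measurable_funeM.
transitivity (\int[mu]_(x in D) (\sum_(r \in range s) f r x)).
  apply: eq_integral => x /set_mem Dx; rewrite EFinM (fimfunE s) -fsumEFin//.
  rewrite ge0_mule_fsuml.
    by apply: eq_fsbigr => r _; rewrite /f EFinM muleA.
  by move=> r; rewrite EFinM; exact: nnfun_muleindic_ge0.
rewrite ge0_integral_fsum//; apply: eq_fsbigr => r /set_mem[t _ <-].
rewrite /f ge0_integralZl//; last 2 first.
- by move=> x Dx; rewrite mule_ge0 ?lee_fin ?p0// indicE.
- by rewrite lee_fin.
congr (_ * _); apply: etrans (lebesgue_measure_substitution (ms (s t))).
rewrite integral_mkcondr.
apply: eq_integral => x _; rewrite patchE indicE.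
have -> : (psi x \in s @^-1` [set s t]) = (x \in psi @^-1` (s @^-1` [set s t])).
  by apply/idP/idP; rewrite !inE.
by case: ifP => _; rewrite ?mul1e ?mul0e.
Qed.

Lemma ge0_integral_substitution (phi : T -> R) :
  measurable_fun setT phi -> (forall y, 0 <= phi y)%R ->
  \int[mu]_(x in D) (phi (psi x) * p x)%:E = \int[mu]_y (phi y)%:E.
Proof.
move=> mphi phi0.
have mphi' : measurable_fun setT (EFin \o phi) by exact/measurable_EFinP.
pose s := nnsfun_approx measurableT mphi'.
have cvs y : (s ^~ y) n @[n --> \oo] --> phi y.
  have := @cvg_nnsfun_approx _ _ _ _ measurableT _ mphi' (fun x _ => phi0 x) y I.
  by move=> /fine_cvg; exact: cvg_trans.
have nds y : nondecreasing_seq (s ^~ y).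
  by move=> m n mn; exact/lefP/nd_nnsfun_approx.
transitivity (limn (fun n => \int[mu]_(y in setT) (s n y)%:E)).
  transitivity (limn (fun n => \int[mu]_(x in D) (s n (psi x) * p x)%:E)).
    rewrite -monotone_convergence//.
    - apply: eq_integral => x _; apply/esym/cvg_lim => //.
      by apply: cvg_EFin; [exact: nearW|apply: cvgM; [exact: cvs|exact: cvg_cst]].
    - move=> n; apply/measurable_EFinP; apply: measurable_funM => //.
      exact: (measurableT_comp _ mpsi).
    - by move=> n x Dx; rewrite lee_fin mulr_ge0 ?p0.
    - by move=> x Dx m n mn; rewrite lee_fin ler_wpM2r ?p0//; exact: nds.
  by congr (limn _); apply/funext => n; exact: subst_simple.
rewrite -monotone_convergence//.
- apply: eq_integral => y _; apply/cvg_lim => //.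
  by apply: cvg_EFin; [exact: nearW|exact: cvs].
- by move=> n; apply/measurable_EFinP.
- by move=> n y _; rewrite lee_fin.
- by move=> y _ m n mn; rewrite lee_fin; exact: nds.
Qed.

End ChangeOfVariables.

(** * The transformation and its density *)

Section TransformationFacts.
Context {R : realType}.
Notation mu := (@lebesgue_measure R).
Notation I := (@unit_itv R).
Implicit Types x y a b : R.
Variable psi : R -> R.
Hypothesis psi_transf : transformation psi.

Let g := transf_inv psi.
Let rho := density psi.
Let p := derive1 psi.

Lemma unit_itv_open : open I. Proof. exact: itv_open. Qed.

Lemma unit_itv_measurable : measurable I. Proof. exact: measurable_itv. Qed.

Lemma unit_itv_interval : is_interval I.
Proof. exact: interval_is_interval. Qed.

Lemma unit_itv_neq0 : I !=set0.
Proof. by exists 0; rewrite /unit_itv/= in_itv/=; apply/andP; split; lra. Qed.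

Lemma subitv_unit a b : I a -> I b -> `[a, b] `<=` I.
Proof.
rewrite /unit_itv/= !in_itv/= => /andP[a1 a2] /andP[b1 b2].
by apply: subset_itv; rewrite bnd_simp.
Qed.

Lemma psi_is_derive x : I x -> is_derive x 1 psi (p x).
Proof.
move=> Ix; have [[d _] _ _ _ _] := psi_transf.
have := d 0%N isT x; rewrite inE => /(_ Ix) dx.
by apply: DeriveDef => //; rewrite /p derive1E.
Qed.

Lemma psi_continuous : {in I, continuous psi}.
Proof. by move=> x; rewrite inE => Ix; apply: is_derive_cont (psi_is_derive Ix). Qed.

Lemma dpsi_continuous : {in I, continuous p}.
Proof. by have [[_ c] _ _ _ _] := psi_transf; rewrite derive1n1 in c. Qed.

Lemma psi_lt x y : I x -> I y -> x < y -> psi x < psi y.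
Proof. by move=> Ix Iy; have [_ h _ _ _] := psi_transf; apply: h; rewrite inE. Qed.

Lemma psi_inj : {in I &, injective psi}.
Proof.
move=> x y /[!inE] Ix Iy e; have [xy|yx|//] := ltgtP x y.
  by have := psi_lt Ix Iy xy; rewrite e ltxx.
by have := psi_lt Iy Ix yx; rewrite e ltxx.
Qed.

Lemma psi_ltE x y : I x -> I y -> (psi x < psi y) = (x < y).
Proof.
move=> Ix Iy; apply/idP/idP; last exact: psi_lt.
have [//|yx|->] := ltgtP x y; last by rewrite ltxx.
by move=> h; have := lt_trans h (psi_lt Iy Ix yx); rewrite ltxx.
Qed.

Lemma psi_surj y : exists2 x, I x & psi x = y.
Proof.
have [_ _ _ [cN cP] _] := psi_transf.
have [a Ia ay] : exists2 a, I a & psi a < y.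
  near ((- 2^-1 : R)^'+) => x; exists x; last by near: x; move/cvgrNyPlt : cN; exact.
  rewrite /unit_itv/= in_itv/=; apply/andP; split; near: x; first exact: nbhs_right_gt.
  by apply: nbhs_right_lt; lra.
have [b Ib yb] : exists2 b, I b & y < psi b.
  near ((2^-1 : R)^'-) => x; exists x; last by near: x; move/cvgryPgt : cP; exact.
  rewrite /unit_itv/= in_itv/=; apply/andP; split; near: x; last exact: nbhs_left_lt.
  by apply: nbhs_left_gt; lra.
have ab : a < b by rewrite -(psi_ltE Ia Ib) (lt_trans ay).
have sub := subitv_unit Ia Ib.
have cw : {within `[a, b], continuous psi}.
  apply: continuous_in_subspaceT => x /set_mem/sub Ix; apply: psi_continuous.
  by rewrite inE.
have [|c /sub Ic <-] := @IVT _ psi a b y (ltW ab) cw; last by exists c.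
by rewrite ge_min le_max (ltW ay) (ltW yb) orbT.
Unshelve. all: by end_near. Qed.

Lemma psi_set_surj : set_surj I setT psi.
Proof. by move=> y _; have [x Ix <-] := psi_surj y; exists x. Qed.

Lemma transf_invK y : psi (g y) = y.
Proof. by apply: (surjpK _ psi_set_surj); rewrite inE. Qed.

Lemma transf_invV x : I x -> g (psi x) = x.
Proof. by move=> Ix; apply: (pinvKV _ psi_inj); rewrite inE. Qed.

Lemma transf_inv_unit y : I (g y).
Proof. by have [x Ix <-] := psi_surj y; rewrite transf_invV. Qed.

Lemma transf_inv_is_derive y : is_derive y 1 g (rho y).
Proof.
have [_ _ _ _ [[d _] _]] := psi_transf.
have := d 0%N isT y; rewrite inE => /(_ Logic.I) dy.
by apply: DeriveDef => //; rewrite /rho /density derive1E.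
Qed.

(** The chain rule for psi^-1 o psi = id; it excludes critical points of psi. *)
Lemma density_dpsi x : I x -> rho (psi x) * p x = 1.
Proof.
move=> Ix.
have d := is_derive_compR (transf_inv_is_derive (psi x)) (psi_is_derive Ix).
have di : is_derive x 1 (fun y => g (psi y)) 1.
  apply: (near_eq_is_derive _ (is_derive_id x 1)).
  have := open_nbhs_nbhs (conj unit_itv_open Ix).
  by apply: filterS => y Iy; rewrite transf_invV.
by have [_ <-] := d; have [_ ->] := di.
Qed.

Lemma density_gt0 y : 0 < rho y.
Proof.
have [_ _ _ _ [[d _] inc]] := psi_transf.
have := density_dpsi (transf_inv_unit y); rewrite transf_invK => e.
rewrite lt_neqAle; apply/andP; split.
  by apply/eqP => h; move/eqP: e; rewrite -h mul0r eq_sym oner_eq0.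
apply: (@incr_derive1_ge0 R g setT) => //.
- by move=> x _; case: (transf_inv_is_derive x).
- by move=> u v _ _; exact: inc.
- by rewrite interiorT.
Qed.

Lemma dpsi_gt0 x : I x -> 0 < p x.
Proof.
move=> Ix; have := density_dpsi Ix.
by rewrite -(pmulr_rgt0 _ (density_gt0 (psi x))) => ->.
Qed.

Lemma dpsiE x : I x -> p x = (rho (psi x))^-1.
Proof. by move=> Ix; rewrite -[LHS]mul1r -(mulVf (lt0r_neq0 (density_gt0 (psi x)))) -mulrA density_dpsi// mulr1. Qed.

Lemma prim_psi : primitive_on I psi p.
Proof.
apply: prim_C1; [exact: unit_itv_open|exact: psi_is_derive|exact: dpsi_continuous].
Qed.

Lemma psi_measurable : measurable_fun I psi.
Proof. exact: open_continuous_measurable_fun unit_itv_open psi_continuous. Qed.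

Lemma dpsi_measurable : measurable_fun I p.
Proof. exact: open_continuous_measurable_fun unit_itv_open dpsi_continuous. Qed.

Lemma psi_preimage_itv a b : a < b ->
  I `&` psi @^-1` `]a, b] = `]g a, g b]%classic.
Proof.
move=> ab; have Ia := transf_inv_unit a; have Ib := transf_inv_unit b.
apply/seteqP; split => x /=; rewrite !in_itv/=.
  move=> [Ix /andP[ax xb]].
  by rewrite -(psi_ltE Ia Ix) transf_invK ax leNgt -(psi_ltE Ib Ix) transf_invK -leNgt.
move=> /andP[ax xb].
have Ix : I x by apply: (subitv_unit Ia Ib); rewrite /= in_itv/= (ltW ax).
split => //.
by rewrite -{1}(transf_invK a) (psi_ltE Ia Ix) ax leNgt -{1}(transf_invK b) (psi_ltE Ib Ix) -leNgt.
Qed.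

(** Over an interval the substitution formula is the fundamental theorem of
    calculus for psi; uniqueness of the Lebesgue measure does the rest. *)
Lemma ge0_integral_psi (phi : R -> R) : measurable_fun setT phi ->
  (forall y, 0 <= phi y) ->
  (\int[mu]_(x in I) (phi (psi x) * p x)%:E = \int[mu]_y (phi y)%:E)%E.
Proof.
move=> mphi phi0; apply: (@ge0_integral_substitution R I psi p) => //.
- exact: unit_itv_measurable.
- exact: psi_measurable.
- exact: dpsi_measurable.
- by move=> x Ix; rewrite ltW// dpsi_gt0.
move=> a b ab; rewrite psi_preimage_itv//.
have gab : g a <= g b.
  rewrite leNgt -(psi_ltE (transf_inv_unit b) (transf_inv_unit a)) !transf_invK.
  by rewrite -leNgt ltW.
have [ip e] := prim_psi gab (subitv_unit (transf_inv_unit a) (transf_inv_unit b)).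
rewrite integral_itv_obnd_cbnd; last first.
  have /measurable_int := ip; apply: measurable_funS => //.
  by apply: subset_itv; rewrite bnd_simp.
rewrite !transf_invK in e; rewrite e /Rintegral fineK//.
exact: integrable_fin_num ip.
Qed.

(** Null sets pull back to null sets, because psi' > 0. *)
Lemma ae_psi (P : R -> Prop) : {ae mu, forall y, P y} ->
  {ae mu, forall x, I x -> P (psi x)}.
Proof.
case=> N [mN muN PN].
have mI := unit_itv_measurable.
have mNI : measurable (I `&` psi @^-1` N) by exact: (psi_measurable mI).
have h := ge0_integral_psi (@measurable_indic _ _ _ setT N mN) (fun y => ltac:(by rewrite indicE)).
have mf : measurable_fun I (fun x => (\1_N (psi x) * p x)%:E).
  apply/measurable_EFinP; apply: measurable_funM; last exact: dpsi_measurable.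
  have mi : measurable_fun setT (\1_N : R -> R) by exact: measurable_indic.
  exact: (measurableT_comp mi psi_measurable).
have : ae_eq mu I (fun x => (\1_N (psi x) * p x)%:E) (cst 0%E).
  apply: ((ae_eq_integral_abs mu mI mf).1 _).
  transitivity (\int[mu]_(x in I) (\1_N (psi x) * p x)%:E)%E.
    apply: eq_integral => x /set_mem Ix; rewrite gee0_abs// lee_fin mulr_ge0 ?indicE//.
    by rewrite ltW// dpsi_gt0.
  by rewrite h integral_indic// setIT.
apply: ae_imply => x h0 Ix; apply: contrapT => nP.
have Nx : N (psi x) by apply: PN.
have := h0 Ix; rewrite indicE mem_set// mul1r => -[] /eqP.
by rewrite gt_eqF// dpsi_gt0.
Qed.

End TransformationFacts.

(** * Composition with the transformation and square-integrable functions *)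

Section Composition.
Context {R : realType}.
Notation mu := (@lebesgue_measure R).
Notation I := (@unit_itv R).
Implicit Types (x y a b : R) (u v F : R -> R).
Variable psi : R -> R.
Hypothesis psi_transf : transformation psi.

Let p := derive1 psi.

Let subst_measurable v (a b : R) : I a -> I b ->
  measurable_fun `[psi a, psi b] v -> measurable_fun `[a, b] (fun x => v (psi x) * p x).
Proof.
move=> Ia Ib mv; have abI := subitv_unit Ia Ib.
apply: measurable_funM; last exact: (measurable_funS unit_itv_measurable abI (dpsi_measurable psi_transf)).
have mvR : measurable_fun setT (v \_ `[psi a, psi b]) by exact/(measurable_restrictT _ _).1.
have mpsi : measurable_fun `[a, b]%classic psi.
  exact: (measurable_funS unit_itv_measurable abI (psi_measurable psi_transf)).
apply: (eq_measurable_fun ((v \_ `[psi a, psi b]) \o psi)).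
  move=> x /set_mem xab /=; rewrite patchE mem_set//=.
  move: (xab); rewrite /= !in_itv/= => /andP[ax xb].
  have Ix := abI _ xab.
  by rewrite !leNgt (psi_ltE psi_transf Ix Ia) (psi_ltE psi_transf Ib Ix) -!leNgt ax.
exact: (measurableT_comp mvR mpsi).
Qed.

Let ge0_subst v (a b : R) : I a -> I b -> measurable_fun `[psi a, psi b] v ->
  (forall y, 0 <= v y) ->
  (\int[mu]_(x in `[a, b]) (v (psi x) * p x)%:E =
   \int[mu]_(y in `[psi a, psi b]) (v y)%:E)%E.
Proof.
move=> Ia Ib mv v0; have abI := subitv_unit Ia Ib.
have mvR : measurable_fun setT (v \_ `[psi a, psi b]) by exact/(measurable_restrictT _ _).1.
have := ge0_integral_psi psi_transf mvR => /(_ _).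
have -> : (\int[mu]_y ((v \_ `[psi a, psi b]) y)%:E =
    \int[mu]_(y in `[psi a, psi b]) (v y)%:E)%E.
  by rewrite [RHS]integral_mkcond restrict_EFin.
move=> <-; last by move=> y; rewrite patchE; case: ifP.
rewrite -(setIidr abI) integral_mkcondr; apply: eq_integral => x /set_mem Ix.
rewrite !patchE.
have -> : (psi x \in `[psi a, psi b]%classic) = (x \in `[a, b]%classic).
  apply/idP/idP; rewrite !inE/= !in_itv/=;
  by rewrite !leNgt (psi_ltE psi_transf Ix Ia) (psi_ltE psi_transf Ib Ix).
by case: ifP => //; rewrite mul0r.
Qed.

(** The substitution formula is applied to the positive and negative parts of v. *)
Lemma prim_comp_psi u v : primitive_on setT u v ->
  primitive_on I (fun x => u (psi x)) (fun x => v (psi x) * p x).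
Proof.
move=> uv a b ab abI.
have Ia : I a by apply: abI; rewrite /= in_itv/= lexx.
have Ib : I b by apply: abI; rewrite /= in_itv/= lexx andbT.
have pab : psi a <= psi b by rewrite leNgt (psi_ltE psi_transf Ib Ia) -leNgt.
have [iv e] := uv _ _ pab (@subsetT _ _).
have mv : measurable_fun `[psi a, psi b] v by have /measurable_int/measurable_EFinP := iv.
pose v1 y := Num.max (v y) 0; pose v2 y := Num.max (- v y) 0.
have v1_0 y : 0 <= v1 y by rewrite le_max lexx orbT.
have v2_0 y : 0 <= v2 y by rewrite le_max lexx orbT.
have v12 y : v y = v1 y - v2 y.
  have [h|h] := leP 0 (v y); rewrite /v1 /v2.
    by rewrite max_l// max_r ?subr0// oppr_le0.
  by rewrite max_r ?(ltW h)// max_l ?sub0r ?opprK// oppr_ge0 ltW.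
have m1 : measurable_fun `[psi a, psi b] v1 by apply: measurable_maxr.
have m2 : measurable_fun `[psi a, psi b] v2.
  by apply: measurable_maxr => //; exact: measurableT_comp.
have le1 y : `|v1 y| <= `|v y|.
  rewrite ger0_norm// ge_max normr_ge0 andbT; exact: ler_norm.
have le2 y : `|v2 y| <= `|v y|.
  rewrite ger0_norm// ge_max normr_ge0 andbT -normrN; exact: ler_norm.
have i1 : mu.-integrable `[psi a, psi b] (EFin \o v1).
  by apply: le_integrable iv => //; [exact/measurable_EFinP|move=> y _ /=; rewrite lee_fin].
have i2 : mu.-integrable `[psi a, psi b] (EFin \o v2).
  by apply: le_integrable iv => //; [exact/measurable_EFinP|move=> y _ /=; rewrite lee_fin].
have key (w : R -> R) : (forall y, 0 <= w y) -> measurable_fun `[psi a, psi b] w ->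
    mu.-integrable `[psi a, psi b] (EFin \o w) ->
    mu.-integrable `[a, b] (EFin \o (fun x => w (psi x) * p x)).
  move=> w0 mw iw; apply/integrableP; split.
    by apply/measurable_EFinP; exact: subst_measurable.
  have wp x : `[a, b]%classic x -> 0 <= w (psi x) * p x.
    by move=> /abI Ix; rewrite mulr_ge0// ltW// (dpsi_gt0 psi_transf).
  rewrite (_ : (\int[mu]_(x in _) _ =
      \int[mu]_(x in `[a, b]) (w (psi x) * p x)%:E)%E); last first.
    by apply: eq_integral => x /set_mem/wp h /=; rewrite ger0_norm.
  rewrite ge0_subst//; move/integrableP : iw => [_]; apply: le_lt_trans.
  rewrite le_eqVlt; apply/orP; left; apply/eqP.
  by apply: eq_integral => y _ /=; rewrite ger0_norm.
have j1 := key _ v1_0 m1 i1; have j2 := key _ v2_0 m2 i2.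
have vE : (fun x => v (psi x) * p x) =
    (fun x => v1 (psi x) * p x - v2 (psi x) * p x).
  by apply/funext => x; rewrite -mulrBl -v12.
split.
  rewrite vE; pose A x := v1 (psi x) * p x; pose B x := v2 (psi x) * p x.
  rewrite -/A -/B (_ : EFin \o _ = (EFin \o A) \- (EFin \o B))%E//.
  exact: integrableB.
rewrite vE RintegralB// e.
rewrite (_ : v = (fun y => v1 y - v2 y)); last by apply/funext.
rewrite RintegralB//; congr (fine _ - fine _); exact/esym/ge0_subst.
Qed.

End Composition.

Section SquareIntegrable.
Context {R : realType}.
Notation mu := (@lebesgue_measure R).
Implicit Types (D : set R) (u v F : R -> R).

Definition square_integrable D F :=
  measurable_fun D F /\ (\int[mu]_(x in D) (F x ^+ 2)%:E < +oo)%E.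

Lemma square_integrableD D u v : measurable D ->
  square_integrable D u -> square_integrable D v ->
  square_integrable D (fun x => u x + v x).
Proof.
move=> mD [mu_ fu] [mv fv]; split; first exact: measurable_funD.
have m2 (w : R -> R) : measurable_fun D w -> measurable_fun D (fun x => (2 * w x ^+ 2)%:E).
  by move=> mw; apply/measurable_EFinP; apply: measurable_funM => //; exact: measurable_funX.
apply: (@le_lt_trans _ _ (\int[mu]_(x in D) ((2 * u x ^+ 2)%:E + (2 * v x ^+ 2)%:E))%E).
  apply: ge0_le_integral => //.
  - by move=> x _; rewrite lee_fin sqr_ge0.
  - by apply/measurable_EFinP; apply: measurable_funX; exact: measurable_funD.
  - by apply: emeasurable_funD; exact: m2.
  - move=> x _; rewrite -EFinD lee_fin -subr_ge0.
    rewrite (_ : _ - _ = (u x - v x) ^+ 2) ?sqr_ge0//; ring.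
have h (w : R -> R) : measurable_fun D w -> (\int[mu]_(x in D) (w x ^+ 2)%:E < +oo)%E ->
    (\int[mu]_(x in D) (2 * w x ^+ 2)%:E < +oo)%E.
  move=> mw fw; under eq_integral do rewrite EFinM.
  rewrite ge0_integralZl//; first by rewrite lte_mul_pinfty.
  - by apply/measurable_EFinP; exact: measurable_funX.
  - by move=> x _; rewrite lee_fin sqr_ge0.
rewrite ge0_integralD//.
- by apply: lte_add_pinfty; exact: h.
- by move=> x _; rewrite lee_fin mulr_ge0// sqr_ge0.
- exact: m2.
- by move=> x _; rewrite lee_fin mulr_ge0// sqr_ge0.
- exact: m2.
Qed.

Lemma square_integrable_ae D u v : measurable D -> measurable_fun D v ->
  ae_eq mu D u v -> square_integrable D u -> square_integrable D v.
Proof.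
move=> mD mv uv [mu_ fu]; split => //; rewrite (_ : (\int[mu]_(x in D) _)%E =
  (\int[mu]_(x in D) (u x ^+ 2)%:E)%E)//.
apply: ae_eq_integral => //.
- by apply/measurable_EFinP; exact: measurable_funX.
- by apply/measurable_EFinP; exact: measurable_funX.
- by apply: ae_imply uv => x h /h ->.
Qed.

(** On sets of finite measure, from |u| <= 1 + u^2. *)
Lemma square_integrable_integrable D u : measurable D -> (mu D < +oo)%E ->
  square_integrable D u -> mu.-integrable D (EFin \o u).
Proof.
move=> mD finD [mu_ fu]; apply/integrableP; split; first exact/measurable_EFinP.
apply: (@le_lt_trans _ _ (\int[mu]_(x in D) ((cst 1 x) + (u x ^+ 2)%:E))%E).
  apply: ge0_le_integral => //.
  - by apply/measurable_EFinP; exact: measurableT_comp.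
  - by apply: emeasurable_funD => //; apply/measurable_EFinP; exact: measurable_funX.
  - move=> x _ /=; rewrite -EFinD lee_fin -(real_normK (num_real (u x))).
    set t := `|u x|; have t0 : 0 <= t by exact: normr_ge0.
    by have := sqr_ge0 (t - 1); rewrite sqrrB1; nra.
rewrite ge0_integralD//.
- by rewrite integral_cst// mul1e; apply: lte_add_pinfty.
- by move=> x _; rewrite lee_fin sqr_ge0.
- by apply/measurable_EFinP; exact: measurable_funX.
Qed.

Lemma prodL2_integrable D u v : measurable D ->
  square_integrable D u -> square_integrable D v ->
  mu.-integrable D (EFin \o (fun x => u x * v x)).
Proof.
move=> mD [mu_ fu] [mv fv]; apply/integrableP; split.
  by apply/measurable_EFinP; exact: measurable_funM.
apply: (@le_lt_trans _ _ (\int[mu]_(x in D) ((u x ^+ 2)%:E + (v x ^+ 2)%:E))%E).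
  apply: ge0_le_integral => //.
  - by apply/measurable_EFinP; apply: measurableT_comp => //; exact: measurable_funM.
  - by apply: emeasurable_funD; apply/measurable_EFinP; exact: measurable_funX.
  - move=> x _ /=; rewrite -EFinD lee_fin normrM.
    rewrite -(real_normK (num_real (u x))) -(real_normK (num_real (v x))).
    set s := `|u x|; set t := `|v x|.
    have s0 : 0 <= s by exact: normr_ge0. have t0 : 0 <= t by exact: normr_ge0.
    by have := sqr_ge0 (s - t); have := mulr_ge0 s0 t0; rewrite sqrrB; nra.
rewrite ge0_integralD//.
- by apply: lte_add_pinfty.
- by move=> x _; rewrite lee_fin sqr_ge0.
- by apply/measurable_EFinP; exact: measurable_funX.
- by move=> x _; rewrite lee_fin sqr_ge0.
- by apply/measurable_EFinP; exact: measurable_funX.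
Qed.

(** The square of a function in H^1 of the line has an integrable derivative,
    hence it is bounded. *)
Lemma prim_L2_bounded u v : primitive_on setT u v ->
  square_integrable setT u -> square_integrable setT v ->
  exists M, forall y, `|u y| <= M.
Proof.
move=> uv su sv; have iuv := prodL2_integrable measurableT su sv.
have puu := primM uv uv.
pose K := \int[mu]_y `|2 * (u y * v y)|.
have i2 : mu.-integrable setT (EFin \o (fun y => 2 * (u y * v y))).
  exact: integrableEFinZ.
have bnd x y : x <= y -> `|u y * u y - u x * u x| <= K.
  move=> xy; have [i ->] := puu _ _ xy (@subsetT _ _).
  apply: le_trans (le_normr_Rintegral _ i) _ => //.
  rewrite /K -lee_fin /Rintegral !fineK; last 2 first.
  - exact: integrable_fin_num (integrable_norm i2).
  - exact: integrable_fin_num (integrable_norm i).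
  rewrite (_ : (\int[mu]_(x0 in `[x, y]) _ =
      \int[mu]_(t in `[x, y]) (`|2 * (u t * v t)|)%:E)%E).
    apply: ge0_subset_integral => //.
    by have /measurable_int := integrable_norm i2.
  by apply: eq_integral => t _; congr (`|_|%:E); ring.
exists (K + u 0 ^+ 2 + 1) => y.
have uy : u y ^+ 2 <= K + u 0 ^+ 2.
  have [h|h] := leP 0 y.
    have := le_trans (ler_norm _) (bnd _ _ h); rewrite -!expr2; lra.
  have := bnd _ _ (ltW h); rewrite distrC => /(le_trans (ler_norm _)).
  by rewrite -!expr2; lra.
apply: le_trans (_ : 1 + u y ^+ 2 <= _); last by lra.
rewrite -(real_normK (num_real (u y))); set t := `|u y|.
have t0 : 0 <= t by exact: normr_ge0.
by have := sqr_ge0 (t - 1); rewrite sqrrB1; nra.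
Qed.

Lemma C0_bounded (f : R -> R) : continuous f ->
  f y @[y --> +oo] --> 0 -> f y @[y --> -oo] --> 0 ->
  exists M, forall y, `|f y| <= M.
Proof.
move=> cf /cvgrPdist_le/(_ 1 ltr01)[a [_ ha]] /cvgrPdist_le/(_ 1 ltr01)[b [_ hb]].
pose c := Num.max `|a| `|b| + 1.
have ca : a < c.
  by rewrite /c ltr_pwDr// le_max ler_norm.
have cb : - c < b.
  rewrite /c ltrNl ltr_pwDr// le_max; apply/orP; right.
  by rewrite -normrN; exact: ler_norm.
have c0 : - c <= c.
  have : 0 <= Num.max `|a| `|b| by rewrite le_max normr_ge0.
  by rewrite /c; lra.
have cn : {within `[- c, c], continuous (fun y => `|f y|)}.
  apply: continuous_subspaceT => y; apply: continuous_comp; first exact: cf.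
  exact: norm_continuous.
have [d _ hd] := EVT_max c0 cn.
exists (Num.max 1 `|f d|) => y; rewrite le_max.
have [yc|yc] := ltP c y.
  by have := ha y (lt_trans ca yc); rewrite sub0r normrN => ->.
have [yd|yd] := ltP y (- c).
  by have := hb y (lt_trans yd cb); rewrite sub0r normrN => ->.
by rewrite hd ?orbT// in_itv/= yd.
Qed.

End SquareIntegrable.

(** * Derivatives of the transformed function *)

Section DensityAlgebra.
Context {R : realType}.
Implicit Types (x y a b : R) (N f : R -> R).
Variables (rho : R -> R) (m : nat).
Hypothesis rho_C0 : forall l, (l <= m)%N -> deriv_in_C0 l rho.

(** The numerators produced by differentiating powers of 1 / rho; the index s
    bounds the order of the derivatives of rho that occur. *)
Inductive density_algebra (s : nat) : (R -> R) -> Prop :=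
| DensityGen t : (t <= s)%N -> density_algebra s (derive1n t rho)
| DensityCst c : density_algebra s (fun=> c)
| DensityAdd f g : density_algebra s f -> density_algebra s g ->
    density_algebra s (fun y => f y + g y)
| DensityMul f g : density_algebra s f -> density_algebra s g ->
    density_algebra s (fun y => f y * g y).

Lemma density_algebra_le s s' N : (s <= s')%N ->
  density_algebra s N -> density_algebra s' N.
Proof.
move=> ss'; elim=> [t ts|c|f g _ Af _ Ag|f g _ Af _ Ag].
- by apply: DensityGen; exact: leq_trans ss'.
- exact: DensityCst.
- exact: DensityAdd.
- exact: DensityMul.
Qed.

Lemma density_derivn_is_derive t y : (t < m)%N ->
  is_derive y 1 (derive1n t rho) (derive1n t.+1 rho y).
Proof.
move=> tm; have [[d _] _ _] := rho_C0 tm.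
by apply: DeriveDef; [apply: d => //; rewrite inE|rewrite derive1nS derive1E].
Qed.

Lemma density_algebra_derive s N : (s < m)%N -> density_algebra s N ->
  exists2 N', density_algebra s.+1 N' & forall y, is_derive y 1 N (N' y).
Proof.
move=> sm; elim=> [t ts|c|f g Af [f' Af' df] Ag [g' Ag' dg]|f g Af [f' Af' df] Ag [g' Ag' dg]].
- exists (derive1n t.+1 rho); first exact: DensityGen.
  by move=> y; apply: density_derivn_is_derive; exact: leq_ltn_trans sm.
- by exists (fun=> 0); [exact: DensityCst|move=> y; exact: is_derive_cstR].
- by exists (fun y => f' y + g' y); [exact: DensityAdd|move=> y; exact: is_deriveDR].
- exists (fun y => f' y * g y + f y * g' y); last by move=> y; exact: is_deriveMR.
  by apply: DensityAdd; apply: DensityMul => //; exact: (density_algebra_le (leqnSn s)).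
Qed.

Lemma density_algebra_continuous s N : (s <= m)%N -> density_algebra s N -> continuous N.
Proof.
move=> sm; elim=> [t ts|c|f g _ cf _ cg|f g _ cf _ cg] y.
- have [[_ c] _ _] := rho_C0 (leq_trans ts sm).
  by apply: c; rewrite inE.
- exact: cst_continuous.
- exact: continuousD (cf y) (cg y).
- exact: continuousM (cf y) (cg y).
Qed.

Lemma density_algebra_bounded s N : (s <= m)%N -> density_algebra s N ->
  exists M, forall y, `|N y| <= M.
Proof.
move=> sm; elim=> [t ts|c|f g _ [Mf bf] _ [Mg bg]|f g _ [Mf bf] _ [Mg bg]].
- have tm := leq_trans ts sm; have [_ cP cN] := rho_C0 tm.
  by apply: C0_bounded => //; apply: (density_algebra_continuous tm); exact: DensityGen.
- by exists `|c|.
- by exists (Mf + Mg) => y; apply: le_trans (ler_normD _ _) _; rewrite lerD.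
- by exists (Mf * Mg) => y; rewrite normrM ler_pM.
Qed.

End DensityAlgebra.

Section Terms.
Context {R : realType}.
Notation mu := (@lebesgue_measure R).
Notation I := (@unit_itv R).
Implicit Types (x y a b : R) (f N F U V : R -> R).
Variables (psi : R -> R) (m : nat) (A D : nat -> R -> R).
Hypothesis psi_transf : transformation psi.

Let rho := density psi.
Let p := derive1 psi.
Let r (y : R) := (rho y)^-1.

Hypothesis rho_C0 : forall l, (l <= m)%N -> deriv_in_C0 l rho.
Hypothesis A_prim : forall k, (k < m)%N -> primitive_on setT (A k) (A k.+1).
Hypothesis A_L2 : forall k, (k <= m)%N -> square_integrable setT (A k).
Hypothesis D_prim : forall k, (k < m)%N -> primitive_on I (D k) (D k.+1).
Hypothesis D_meas : forall k, (k <= m)%N -> measurable_fun I (D k).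
Hypothesis D_bound0 : forall n, (n <= m)%N ->
  exists C, {ae mu, forall x, I x -> `|D n x| <= C * Num.sqrt (p x)}.
Hypothesis D_bound1 : forall j k, (j + k < m)%N ->
  exists C, {ae mu, forall x, I x -> `|D j x| * p x ^+ (2 * k) * Num.sqrt (p x) <= C}.

(** The functions of which the n-th derivative of (A 0 o psi) * D 0 is made: in
    the second kind of summand, k derivatives fell on the composition and j on
    the weight.  Since psi' = r o psi and psi'' = - (rho' o psi) * psi'^3, each
    derivative of the composition raises the power of r by 1 together with the
    index i, or by 2. *)
Inductive derivative_sum (n : nat) : (R -> R) -> Prop :=
| TermWeight : derivative_sum n (fun x => A 0 (psi x) * D n x)
| TermChain i k j N : (k + j)%N = n -> (0 < i <= k)%N -> density_algebra rho k N ->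
    derivative_sum n (fun x => A i (psi x) * (N (psi x) * r (psi x) ^+ (2 * k - i)) * D j x)
| TermAdd F G : derivative_sum n F -> derivative_sum n G ->
    derivative_sum n (fun x => F x + G x).

Let rho_gt0 y : 0 < rho y. Proof. exact: density_gt0. Qed.

Let r_gt0 y : 0 < r y. Proof. by rewrite invr_gt0. Qed.

Let pE x : I x -> p x = r (psi x). Proof. exact: dpsiE. Qed.

Let p_gt0 x : I x -> 0 < p x. Proof. exact: dpsi_gt0. Qed.

Let rho_bounded : exists2 K, 0 < K & forall y, rho y <= K.
Proof.
have A0 : density_algebra rho 0 rho by exact: (@DensityGen R rho 0 0).
have [K bK] := density_algebra_bounded rho_C0 (leq0n m) A0.
exists K; first by apply: lt_le_trans (rho_gt0 0) (le_trans (ler_norm _) (bK 0)).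
by move=> y; exact: le_trans (ler_norm _) (bK y).
Qed.

Let rX_le e e' : (e <= e')%N -> exists2 C, 0 < C & forall y, r y ^+ e <= C * r y ^+ e'.
Proof.
move=> ee'; have [K K0 bK] := rho_bounded.
exists (K ^+ (e' - e)); first exact: exprn_gt0.
move=> y; rewrite -{2}(subnK ee') exprD mulrA -exprMn ler_peMl ?exprn_ge0 ?(ltW (r_gt0 y))//.
by rewrite exprn_ege1// /r ler_pdivlMr// mul1r.
Qed.

(** With (r^e)' = - e * rho' * r^(e+1) the quotient rule gives a new numerator
    over two more powers of rho; the extra factor rho is the one that the chain
    rule, psi' = r o psi, cancels. *)
Let prim_coef k i N : (k < m)%N -> (0 < i <= k)%N -> density_algebra rho k N ->
  exists2 N', density_algebra rho k.+1 N' &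
    primitive_on setT (fun y => N y * r y ^+ (2 * k - i))
                      (fun y => N' y * r y ^+ (2 * k.+1 - i) * rho y).
Proof.
move=> km /andP[i0 ik] AN; have [N1 AN1 dN] := density_algebra_derive rho_C0 km AN.
have e0 : (0 < 2 * k - i)%N by rewrite subn_gt0; lia.
pose rho1 := derive1n 1 rho; set e := (2 * k - i)%N.
have m0 : (0 < m)%N := leq_ltn_trans (leq0n k) km.
exists (fun y => N1 y * rho y + - e%:R * rho1 y * N y).
  apply: DensityAdd; first by apply: DensityMul => //; exact: (@DensityGen _ _ _ 0).
  apply: DensityMul; last exact: (density_algebra_le (leqnSn k)).
  by apply: DensityMul; [exact: DensityCst|exact: (@DensityGen _ _ _ 1)].
have dq y : is_derive y 1 (fun y => N y * r y ^+ e)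
    ((N1 y * rho y + - e%:R * rho1 y * N y) * r y ^+ (2 * k.+1 - i) * rho y).
  have drho : is_derive y 1 rho (rho1 y) by exact: (density_derivn_is_derive rho_C0 _ m0).
  have dr := is_deriveVR (lt0r_neq0 (rho_gt0 y)) drho.
  apply: (is_derive_eq (is_deriveMR (dN y) (is_deriveXR e dr))).
  rewrite -/(r y) (_ : (2 * k.+1 - i = e.-1.+3)%N); last by rewrite /e; lia.
  have -> : r y ^+ e = r y * r y ^+ e.-1 by rewrite -exprS prednK.
  rewrite !exprS; set z := r y ^+ _; set s := rho y.
  have sr : s * r y = 1 by apply: mulfV; exact: lt0r_neq0 (rho_gt0 _).
  rewrite [RHS](_ : _ = N1 y * (r y * z) * (s * r y) ^+ 2
    - e%:R * rho1 y * N y * z * r y ^+ 2 * (s * r y)); last by ring.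
  by rewrite sr; ring.
apply: prim_C1; [exact: openT|].
move=> y _; have cN1 : {for y, continuous N1} by exact: (density_algebra_continuous rho_C0 km AN1).
have cN : {for y, continuous N} by exact: (density_algebra_continuous rho_C0 (ltnW km) AN).
have crho : {for y, continuous rho}.
  by apply: (density_algebra_continuous rho_C0 (leq0n m)); exact: (@DensityGen _ _ 0 0).
have crho1 : {for y, continuous rho1}.
  by apply: (density_algebra_continuous rho_C0 m0); exact: (@DensityGen _ _ 1 1).
have cr : {for y, continuous r} by apply: continuousV => //; exact: lt0r_neq0 (rho_gt0 _).
have crX n : {for y, continuous (fun y => r y ^+ n)}.
  by apply: (@continuous_comp _ _ _ r (fun z => z ^+ n)) => //; exact: exprn_continuous.
have c1 := continuousM cN1 crho.
have c2 := continuousM (continuousM (@cst_continuous R R (- e%:R) y) crho1) cN.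
exact: (continuousM (continuousM (continuousD c1 c2) (crX _)) crho).
Qed.

Let prim_mulDl U U' n : (n < m)%N -> primitive_on I U U' ->
  primitive_on I (fun x => U x * D n x) (fun x => U' x * D n x + U x * D n.+1 x).
Proof. by move=> nm pU; apply: primM => //; exact: D_prim. Qed.

Lemma derivative_sum_prim n F : (n < m)%N -> derivative_sum n F ->
  exists2 F', derivative_sum n.+1 F' & primitive_on I F F'.
Proof.
move=> nm; elim=> [|i k j N kjn ik AN|{}F G _ [F' TF' pF] _ [G' TG' pG]].
- have p0 := prim_comp_psi psi_transf (A_prim (leq_ltn_trans (leq0n n) nm)).
  exists (fun x => A 1 (psi x) * (1 * r (psi x) ^+ (2 * 1 - 1)) * D n x +
    A 0 (psi x) * D n.+1 x).
    apply: TermAdd; last exact: TermWeight.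
    by apply: (TermChain (N := fun=> 1)) => //; exact: DensityCst.
  apply: prim_eq (prim_mulDl nm p0) _ => x /[!inE] Ix.
  by rewrite mul1r -/p pE// expr1.
- have km : (k < m)%N by rewrite (leq_ltn_trans _ nm)// -kjn leq_addr.
  have jm : (j < m)%N by rewrite (leq_ltn_trans _ nm)// -kjn leq_addl.
  have /andP[i0 ik'] := ik.
  have [N' AN' pq] := prim_coef km ik AN.
  have pA := primM (A_prim (leq_ltn_trans ik' km)) pq.
  have := prim_mulDl jm (prim_comp_psi psi_transf pA) => /= pT.
  exists (fun x => A i.+1 (psi x) * (N (psi x) * r (psi x) ^+ (2 * k.+1 - i.+1)) * D j x +
    A i (psi x) * (N' (psi x) * r (psi x) ^+ (2 * k.+1 - i)) * D j x +
    A i (psi x) * (N (psi x) * r (psi x) ^+ (2 * k - i)) * D j.+1 x).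
    apply: TermAdd; first apply: TermAdd.
    + by apply: TermChain; rewrite ?addSn ?kjn//; exact: (density_algebra_le (leqnSn k)).
    + by apply: TermChain; rewrite ?addSn ?kjn// i0 (leq_trans ik').
    + by apply: TermChain; rewrite ?addnS ?kjn//.
  apply: prim_eq pT _ => x /[!inE] Ix; rewrite -/p pE//.
  have -> : (2 * k.+1 - i.+1 = (2 * k - i).+1)%N by lia.
  rewrite exprS; set y := psi x.
  have ry : rho y * r y = 1 by apply: mulfV; exact: lt0r_neq0 (rho_gt0 _).
  rewrite [LHS](_ : _ = A i.+1 y * (N y * (r y * r y ^+ (2 * k - i))) * D j x +
    A i y * (N' y * r y ^+ (2 * k.+1 - i) * (rho y * r y)) * D j x +
    A i y * (N y * r y ^+ (2 * k - i)) * D j.+1 x); last by ring.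
  by rewrite ry mulr1.
- by exists (fun x => F' x + G' x); [exact: TermAdd|exact: primD].
Qed.

Let measurable_comp_psi U : measurable_fun setT U -> measurable_fun I (fun x => U (psi x)).
Proof. by move=> mU; exact: (measurableT_comp mU (psi_measurable psi_transf)). Qed.

(** The exponents in the bounds on the weight are tuned so that every summand
    is dominated by |A i o psi| * sqrt psi', whose square integral over the unit
    interval is that of (A i)^2 over the line. *)
Let dominated_L2 i F C : (i <= m)%N -> measurable_fun I F ->
  {ae mu, forall x, I x -> `|F x| <= C * (`|A i (psi x)| * Num.sqrt (p x))} ->
  square_integrable I F.
Proof.
move=> im mF bF; split => //; have mI := @unit_itv_measurable R.
have [mA fA] := A_L2 im.
have mA2 : measurable_fun setT (fun y => C ^+ 2 * A i y ^+ 2).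
  by apply: measurable_funM => //; exact: measurable_funX.
have A20 y : 0 <= C ^+ 2 * A i y ^+ 2 by rewrite mulr_ge0// sqr_ge0.
apply: (@le_lt_trans _ _ (\int[mu]_(x in I) (C ^+ 2 * A i (psi x) ^+ 2 * p x)%:E)%E).
  apply: ae_ge0_le_integral => //.
  - by move=> x _; rewrite lee_fin sqr_ge0.
  - by apply/measurable_EFinP; exact: measurable_funX.
  - by move=> x Ix; rewrite lee_fin mulr_ge0// ltW// p_gt0.
  - apply/measurable_EFinP; apply: measurable_funM; last exact: dpsi_measurable.
    exact: (measurable_comp_psi mA2).
  - apply: ae_imply bF => x + Ix => /(_ Ix) bx; rewrite lee_fin.
    rewrite -(real_normK (num_real (F x))).
    have bx0 := le_trans (normr_ge0 _) bx.
    apply: le_trans (_ : (C * (`|A i (psi x)| * Num.sqrt (p x))) ^+ 2 <= _).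
      by rewrite ler_sqr ?nnegrE.
    by rewrite !exprMn sqr_sqrtr ?(ltW (p_gt0 Ix))// real_normK ?num_real// mulrA.
rewrite (ge0_integral_psi psi_transf mA2)//.
under eq_integral do rewrite EFinM.
rewrite ge0_integralZl//.
- by rewrite lte_mul_pinfty// lee_fin sqr_ge0.
- by apply/measurable_EFinP; exact: measurable_funX.
- by move=> x _; rewrite lee_fin sqr_ge0.
- by rewrite lee_fin sqr_ge0.
Qed.

Lemma derivative_sum_L2 n F : (n <= m)%N -> derivative_sum n F -> square_integrable I F.
Proof.
move=> nm; elim=> [|i k j N kjn ik AN|{}F G _ sF _ sG]; last first.
- by apply: square_integrableD => //; exact: unit_itv_measurable.
- have /andP[i0 ik'] := ik.
  have km : (k <= m)%N by rewrite (leq_trans _ nm)// -kjn leq_addr.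
  have jm : (j <= m)%N by rewrite (leq_trans _ nm)// -kjn leq_addl.
  have im := leq_trans ik' km.
  have [M bM] := density_algebra_bounded rho_C0 km AN.
  have M0 : 0 <= M by exact: le_trans (normr_ge0 _) (bM 0).
  (* As i >= 1, the exponent 2k - i is at most 2(k - 1) + 1; one square root of
     the last factor psi' goes to the bound on the weight, the other one to A i. *)
  have [|C bC] := @D_bound1 j k.-1; first by lia.
  have [K K0 bK] : exists2 K, 0 < K & forall y, r y ^+ (2 * k - i) <= K * r y ^+ (2 * k.-1).+1.
    by apply: rX_le; lia.
  apply: (@dominated_L2 i _ (M * K * C)) => //.
    apply: measurable_funM; last exact: D_meas.
    have [mA _] := A_L2 im.
    apply: (@measurable_comp_psi (fun y => A i y * (N y * r y ^+ (2 * k - i)))).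
    apply: measurable_funM => //; apply: measurable_funM.
      exact: continuous_measurable_fun (density_algebra_continuous rho_C0 km AN).
    apply: measurable_funX; apply: continuous_measurable_fun => y.
    apply: continuousV; first exact: lt0r_neq0 (rho_gt0 _).
    by apply: (density_algebra_continuous rho_C0 (leq0n m)); exact: (@DensityGen _ _ 0 0).
  apply: ae_imply bC => x + Ix => /(_ Ix) bx.
  rewrite !normrM (ger0_norm (exprn_ge0 _ (ltW (r_gt0 _)))).
  have qD : r (psi x) ^+ (2 * k - i) * `|D j x| <= K * C * Num.sqrt (p x).
    apply: le_trans (ler_wpM2r (normr_ge0 _) (bK (psi x))) _.
    rewrite exprSr -pE// -{2}(sqr_sqrtr (ltW (p_gt0 Ix))).
    set t := Num.sqrt (p x); rewrite (_ : _ * `|D j x| =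
      K * t * (`|D j x| * p x ^+ (2 * k.-1) * t)); last by ring.
    by rewrite [leRHS]mulrAC ler_wpM2l// mulr_ge0 ?sqrtr_ge0// ltW.
  set d := `|D j x| in bx qD *; set t := Num.sqrt (p x) in bx qD *.
  set q := r (psi x) ^+ _ in qD *; set a := `|A i (psi x)|; set c := `|N (psi x)|.
  rewrite (_ : a * (c * q) * d = a * (c * (q * d))); last by ring.
  rewrite (_ : M * K * C * (a * t) = a * (M * (K * C * t))); last by ring.
  apply: ler_wpM2l; first exact: normr_ge0.
  apply: ler_pM; [exact: normr_ge0| |exact: bM|exact: qD].
  by rewrite mulr_ge0 ?normr_ge0// exprn_ge0// ltW.
- have [C bC] := D_bound0 nm.
  apply: (@dominated_L2 0 _ C) => //.
    apply: measurable_funM; last exact: D_meas.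
    by have [mA _] := A_L2 (leq0n m); exact: measurable_comp_psi.
  apply: ae_imply bC => x + Ix => /(_ Ix) bx; rewrite normrM mulrCA.
  by apply: ler_wpM2l.
Qed.

Let ae_le_continuous f C : {in I, continuous f} ->
  {ae mu, forall x, I x -> f x <= C} -> forall x, I x -> f x <= C.
Proof.
move=> cf bf x Ix; rewrite leNgt; apply/negP => Cf.
have cfx : {for x, continuous f} by apply: cf; rewrite inE.
have : \forall y \near x, I y /\ C < f y.
  near=> y; split; first by near: y; exact: open_nbhs_nbhs (conj unit_itv_open Ix).
  by near: y; exact: (cvgr_gt (f x) cfx).
move=> /nbhs_ballP[e /= e0 h].
have bB : {ae mu, forall y, ball x e y -> I y -> f y <= C}.
  by apply: ae_imply bf => y b _.
have oB : open (ball x e) by exact: ball_open.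
have [|y /h[Iy Cy]] := open_ae_point oB _ bB; first by exists x; exact: ballxx.
by move=> /(_ Iy); rewrite leNgt Cy.
Unshelve. all: by end_near. Qed.

Let D_bound1_everywhere j k : (j + k < m)%N ->
  exists C, forall x, I x -> `|D j x| * p x ^+ (2 * k) * Num.sqrt (p x) <= C.
Proof.
move=> jkm; have [C bC] := D_bound1 jkm; exists C; apply: ae_le_continuous bC => x Ix.
have jm : (j < m)%N by rewrite (leq_ltn_trans _ jkm)// leq_addr.
have cD : {for x, continuous (D j)}.
  exact: (prim_continuous unit_itv_open (D_prim jm) Ix).
have cp : {for x, continuous p} by exact: (dpsi_continuous psi_transf Ix).
have cD' : {for x, continuous (fun x => `|D j x|)}.
  by apply: (@continuous_comp _ _ _ (D j) (fun z => `|z|)) => //; exact: norm_continuous.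
have cp' : {for x, continuous (fun x => p x ^+ (2 * k))}.
  by apply: (@continuous_comp _ _ _ p (fun z => z ^+ (2 * k))) => //; exact: exprn_continuous.
have cs : {for x, continuous (fun x => Num.sqrt (p x))}.
  by apply: (@continuous_comp _ _ _ p Num.sqrt) => //; exact: sqrt_continuous.
exact: (continuousM (continuousM cD' cp') cs).
Qed.

(** Below the top order the exponents leave a factor 1 / sqrt psi', which
    vanishes at the endpoints. *)
Lemma derivative_sum_decay n F : (n < m)%N -> derivative_sum n F ->
  exists C, forall x, I x -> `|F x| * Num.sqrt (p x) <= C.
Proof.
have A_bounded i : (i < m)%N -> exists2 M, 0 <= M & forall y, `|A i y| <= M.
  move=> im; have [M bM] := prim_L2_bounded (A_prim im) (A_L2 (ltnW im)) (A_L2 im).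
  by exists M => //; exact: le_trans (bM 0).
move=> nm; elim=> [|i k j N kjn ik AN|{}F G _ [C bC] _ [C' bC']].
- have [M M0 bM] := A_bounded 0%N (leq_ltn_trans (leq0n n) nm).
  have [|C bC] := @D_bound1_everywhere n 0; first by rewrite addn0.
  exists (M * C) => x Ix; have := bC x Ix; rewrite muln0 expr0 mulr1 => b.
  rewrite normrM -mulrA; apply: ler_pM; [exact: normr_ge0| |exact: bM|exact: b].
  by rewrite mulr_ge0// sqrtr_ge0.
- have /andP[i0 ik'] := ik.
  have km : (k < m)%N by rewrite (leq_ltn_trans _ nm)// -kjn leq_addr.
  have [M M0 bM] := A_bounded i (leq_ltn_trans ik' km).
  have [L bL] := density_algebra_bounded rho_C0 (ltnW km) AN.
  have L0 : 0 <= L by exact: le_trans (normr_ge0 _) (bL 0).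
  have [|C bC] := @D_bound1_everywhere j k; first by rewrite addnC kjn.
  have [K K0 bK] : exists2 K, 0 < K & forall y, r y ^+ (2 * k - i) <= K * r y ^+ (2 * k).
    by apply: rX_le; lia.
  exists (M * (L * (K * C))) => x Ix; have b := bC x Ix; have c := bK (psi x).
  rewrite -pE// in c.
  rewrite !normrM (ger0_norm (exprn_ge0 _ (ltW (r_gt0 _)))) -pE//.
  set d := `|D j x| in b *; set t := Num.sqrt (p x) in b *.
  set q := p x ^+ (2 * k - i) in c *.
  rewrite [leLHS](_ : _ = `|A i (psi x)| * (`|N (psi x)| * (q * (d * t)))); last by ring.
  have t0 : 0 <= t by exact: sqrtr_ge0.
  have d0 : 0 <= d by exact: normr_ge0.
  have q0 : 0 <= q by rewrite exprn_ge0// ltW// p_gt0.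
  have qdt0 : 0 <= q * (d * t) by rewrite !mulr_ge0.
  apply: ler_pM; [exact: normr_ge0|by rewrite mulr_ge0|exact: bM|].
  apply: ler_pM; [exact: normr_ge0|exact: qdt0|exact: bL|].
  apply: le_trans (ler_wpM2r (mulr_ge0 d0 t0) c) _.
  by rewrite -mulrA ler_pM2l// mulrCA mulrA.
- exists (C + C') => x Ix; have b := bC x Ix; have b' := bC' x Ix.
  apply: le_trans (ler_wpM2r (sqrtr_ge0 _) (ler_normD _ _)) _.
  by rewrite mulrDl lerD.
Qed.

End Terms.

(** * Integration by parts on the torus *)

Section EndpointDecay.
Context {R : realType}.
Notation mu := (@lebesgue_measure R).
Notation I := (@unit_itv R).
Implicit Types (x y a b : R) (u v F phi : R -> R).
Variable psi : R -> R.
Hypothesis psi_transf : transformation psi.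

Let p := derive1 psi.
Let rho := density psi.

Definition right_approx (n : nat) : R := 2^-1 - n.+3%:R^-1.

Lemma right_approx_unit n : I (right_approx n) /\ I (- right_approx n).
Proof.
have n0 : 0 < n.+3%:R^-1 :> R by rewrite invr_gt0.
have n1 : n.+3%:R^-1 < 2^-1 :> R by rewrite ltf_pV2 ?posrE// ltr_nat.
rewrite /unit_itv/= !in_itv/= /right_approx; set e := n.+3%:R^-1 in n0 n1 *.
by split; apply/andP; split; lra.
Qed.

Lemma right_approx_near x : I x ->
  \forall n \near \oo, - right_approx n < x < right_approx n.
Proof.
rewrite /unit_itv/= in_itv/= => /andP[x1 x2].
pose d := Num.min (x + 2^-1) (2^-1 - x).
have d0 : 0 < d by rewrite lt_min; apply/andP; split; lra.
have d1 : d <= x + 2^-1 by rewrite ge_min lexx.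
have d2 : d <= 2^-1 - x by rewrite ge_min lexx orbT.
have := @cvg_harmonic R => /cvgrPdist_lt/(_ d d0); apply: filterS => n.
rewrite sub0r normrN ger0_norm /harmonic ?invr_ge0// => nd.
have n3 : n.+3%:R^-1 <= n.+1%:R^-1 :> R by rewrite lef_pV2 ?posrE// ler_nat; lia.
have ed := le_lt_trans n3 nd; rewrite /right_approx; set e := n.+3%:R^-1 in ed *.
by apply/andP; split; lra.
Qed.

Lemma psi_right_cvg : psi (right_approx n) @[n --> \oo] --> +oo.
Proof.
apply/cvgryPge => a; have [x Ix <-] := psi_surj psi_transf a.
have := right_approx_near Ix; apply: filterS => n /andP[_ xn].
exact: (ltW (psi_lt psi_transf Ix (right_approx_unit n).1 xn)).
Qed.

Lemma psi_left_cvg : psi (- right_approx n) @[n --> \oo] --> -oo.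
Proof.
apply/cvgrNyPle => a; have [x Ix <-] := psi_surj psi_transf a.
have := right_approx_near Ix; apply: filterS => n /andP[xn _].
exact/ltW/(psi_lt psi_transf (right_approx_unit n).2 Ix xn).
Qed.

Lemma Rintegral_unit_cvg u : mu.-integrable I (EFin \o u) ->
  \int[mu]_(x in `[- right_approx n, right_approx n]) u x @[n --> \oo] -->
  \int[mu]_(x in I) u x.
Proof.
move=> iu; have mu_ : measurable_fun I u by have /measurable_int/measurable_EFinP := iu.
pose J n : set R := `[- right_approx n, right_approx n]%classic.
have JI n : J n `<=` I.
  by have [h1 h2] := right_approx_unit n; exact: subitv_unit.
have cv : \int[mu]_(x in I) ((u \_ (J n)) x) @[n --> \oo] --> \int[mu]_(x in I) u x.
  apply: (@Rdominated_cvg R I _ _ (fun x => `|u x|)) => //.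
  - exact: unit_itv_measurable.
  - move=> n; have mJ : measurable (J n) by exact: measurable_itv.
    apply: ((measurable_restrict u mJ (@unit_itv_measurable R)).1 _).
    by apply: measurable_funS mu_ => [|x [_]//]; exact: unit_itv_measurable.
  - apply: ae_all => x Ix; apply: cvg_near_cst.
    have := right_approx_near Ix; apply: filterS => n /andP[xn nx].
    by rewrite patchE mem_set// /J/= in_itv/= !ltW.
  - exact: integrable_norm.
  - by move=> n x _; rewrite patchE; case: ifP => //; rewrite normr0.
apply: cvg_trans cv; apply: near_eq_cvg; apply: nearW => n.
by rewrite -Rintegral_mkcondr (setIidr (JI n)).
Qed.

Hypothesis rho_right : rho y @[y --> +oo] --> 0.
Hypothesis rho_left : rho y @[y --> -oo] --> 0.

Lemma decay_cvg F C (s : nat -> R) : (forall n, I (s n)) ->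
  (forall x, I x -> `|F x| * Num.sqrt (p x) <= C) ->
  rho (psi (s n)) @[n --> \oo] --> 0 -> F (s n) @[n --> \oo] --> 0.
Proof.
move=> Is bF cv; apply/norm_cvg0P.
have cs : C * Num.sqrt (rho (psi (s n))) @[n --> \oo] --> 0.
  rewrite -[X in _ --> X](mulr0 C) -[X in C * X]sqrtr0.
  apply: cvgM; first exact: cvg_cst.
  by apply: (cvg_comp _ _ cv); exact: sqrt_continuous.
apply: (@squeeze_cvgr _ _ _ _ (fun=> 0) (fun n => C * Num.sqrt (rho (psi (s n))))) => //.
  apply: nearW => n; rewrite normr_ge0/=.
  have := bF _ (Is n); rewrite /p dpsiE// -/rho.
  rewrite (sqrtrV (ltW (density_gt0 psi_transf _))) ler_pdivrMr//.
  by rewrite sqrtr_gt0 density_gt0.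
exact: cvg_cst.
Qed.

(** The bound on F says |F| <= C * sqrt (rho o psi), which tends to 0 at both
    endpoints, so that no boundary term survives. *)
Lemma torus_integration_by_parts F F' C phi : primitive_on I F F' ->
  mu.-integrable I (EFin \o F) -> mu.-integrable I (EFin \o F') ->
  (forall x, I x -> `|F x| * Num.sqrt (p x) <= C) -> smooth phi ->
  \int[mu]_(x in I) (F x * derive1 phi x) = - \int[mu]_(x in I) (F' x * phi x).
Proof.
move=> pF iF iF' bF sphi.
have dphi x : is_derive x 1 phi (derive1 phi x).
  have [d _] := sphi 1%N; apply: DeriveDef; last by rewrite derive1E.
  by apply: (d 0%N isT); rewrite inE.
have cdphi : continuous (derive1 phi).
  by move=> x; have [_ c] := sphi 1%N; rewrite derive1n1 in c; apply: c; rewrite inE.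
have cphi : continuous phi by move=> x; exact: is_derive_cont.
have bounded u : continuous u -> exists M, forall x, I x -> `|u x| <= M.
  move=> cu; have ab : - 2^-1 <= 2^-1 :> R by lra.
  have cn : {within `[- 2^-1, 2^-1], continuous (fun x => `|u x|)}.
    apply: continuous_subspaceT => y; apply: continuous_comp; first exact: cu.
    exact: norm_continuous.
  have [d _ hd] := EVT_max ab cn; exists `|u d| => x; rewrite /unit_itv/= => Ix.
  by apply: hd; exact: subset_itv_oo_cc.
have [M1 b1] := bounded _ cphi; have [M2 b2] := bounded _ cdphi.
have mI := @unit_itv_measurable R.
have i1 : mu.-integrable I (EFin \o (fun x => phi x * F' x)).
  apply: (integrableM_bounded mI _ b1 iF').
  by apply: (measurable_funS measurableT) => //; exact: continuous_measurable_fun.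
have i2 : mu.-integrable I (EFin \o (fun x => derive1 phi x * F x)).
  apply: (integrableM_bounded mI _ b2 iF).
  by apply: (measurable_funS measurableT) => //; exact: continuous_measurable_fun.
rewrite (_ : (fun x => phi x * F' x) = (fun x => F' x * phi x)) in i1; last first.
  by apply/funext => x; rewrite mulrC.
rewrite (_ : (fun x => _ * F x) = (fun x => F x * derive1 phi x)) in i2; last first.
  by apply/funext => x; rewrite mulrC.
have pphi : primitive_on I phi (derive1 phi).
  by apply: prim_C1; [exact: unit_itv_open|move=> x _; exact: cdphi].
have pFphi := primM pF pphi.
have cv := Rintegral_unit_cvg (integrableEFinD mI i1 i2).
have boundary n : \int[mu]_(x in `[- right_approx n, right_approx n])
    (F' x * phi x + F x * derive1 phi x) =
    F (right_approx n) * phi (right_approx n) -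
    F (- right_approx n) * phi (- right_approx n).
  have [IP IN] := right_approx_unit n.
  have h : - right_approx n <= right_approx n.
    have : n.+3%:R^-1 < 2^-1 :> R by rewrite ltf_pV2 ?posrE// ltr_nat.
    by rewrite /right_approx; set e := n.+3%:R^-1; lra.
  by have [_ <-] := pFphi _ _ h (subitv_unit IN IP).
have cv0 : (F (right_approx n) * phi (right_approx n) -
    F (- right_approx n) * phi (- right_approx n)) @[n --> \oo] --> 0.
  have small (s : nat -> R) : (forall n, I (s n)) -> F (s n) @[n --> \oo] --> 0 ->
      F (s n) * phi (s n) @[n --> \oo] --> 0.
    move=> Is cF; apply/norm_cvg0P.
    apply: (@squeeze_cvgr _ _ _ _ (fun=> 0) (fun n => `|F (s n)| * M1)).
    - by apply: nearW => n; rewrite normr_ge0/= normrM ler_wpM2l// b1.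
    - exact: cvg_cst.
    - rewrite -[X in _ --> X](mul0r M1); apply: cvgM; last exact: cvg_cst.
      by apply/norm_cvg0P.
  rewrite -[X in _ --> X](subr0 0); apply: cvgB; apply: small.
  - by move=> n; have [] := right_approx_unit n.
  - apply: (decay_cvg _ bF); first by move=> n; have [] := right_approx_unit n.
    exact: (cvg_comp _ _ psi_right_cvg rho_right).
  - by move=> n; have [] := right_approx_unit n.
  - apply: (decay_cvg _ bF); first by move=> n; have [] := right_approx_unit n.
    exact: (cvg_comp _ _ psi_left_cvg rho_left).
have : \int[mu]_(x in I) (F' x * phi x + F x * derive1 phi x) = 0.
  apply: (cvg_unique _ cv); first exact: Rhausdorff.
  by apply: cvg_trans cv0; apply: near_eq_cvg; apply: nearW => n; rewrite boundary.
by rewrite RintegralD// => /eqP; rewrite addrC addr_eq0 => /eqP.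
Qed.

End EndpointDecay.

(** * The real-valued case *)

Section RealTheorem.
Context {R : realType}.
Notation mu := (@lebesgue_measure R).
Notation I := (@unit_itv R).
Implicit Types (x y a b C : R) (J D : set R) (F phi : R -> R).

(** The function u itself is the zeroth member of the chain: the given weak
    derivative of order 0 agrees with it almost everywhere. *)
Lemma weak_deriv_chain J m (u : R -> R) (H : nat -> R -> R) : open J ->
  is_interval J -> J !=set0 ->
  (forall k, (k <= m)%N -> weak_deriv_real J k u (H k)) ->
  exists A : nat -> R -> R,
    [/\ ae_eq mu J u (A 0),
        forall k, (k <= m)%N -> ae_eq mu J (H k) (A k),
        forall k, (k <= m)%N -> measurable_fun J (A k) &
        forall k, (k < m)%N -> primitive_on J (A k) (A k.+1)].
Proof.
move=> oJ iJ J0 dH; pose H' k := if k is 0%N then u else H k.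
have uH0 : ae_eq mu J u (H 0%N) by exact: weak_deriv0_ae (dH 0%N (leq0n m)).
have [|A [eA mA pA]] := @weak_deriv_representatives R J m H' oJ iJ J0.
  case=> [_|k km]; last exact: dH.
  have [lu _ _] := dH 0%N (leq0n m); split => // phi _.
  by rewrite expr0 mul1r derive1n0.
exists A; split => //; first exact: (eA 0%N (leq0n m)).
case=> [_|k km]; last exact: (eA k.+1).
by apply: ae_imply2 uH0 (eA 0%N (leq0n m)) => x h1 h2 Jx; rewrite -(h1 Jx); exact: h2.
Qed.

Lemma weight_exponent0 (t : R) : 0 < t ->
  t `^ Num.max (- 2^-1) (2 * 0%:R - 3 / 2) = (Num.sqrt t)^-1.
Proof.
move=> t0; have h : (2 * 0 - 3 / 2 : R) <= - 2^-1 by lra.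
rewrite (_ : Num.max _ _ = - (2^-1 : R)); last exact: max_l h.
by rewrite powRN powR12_sqrt// ltW.
Qed.

Lemma weight_exponentS k (t : R) : 0 < t ->
  t `^ Num.max (- 2^-1) (2 * k.+1%:R - 3 / 2) = t ^+ (2 * k) * Num.sqrt t.
Proof.
move=> t0; have k0 : 0 <= k%:R :> R by rewrite ler0n.
have h : (- 2^-1 : R) <= 2 * k.+1%:R - 3 / 2 by rewrite -(natr1 k); lra.
rewrite (_ : Num.max _ _ = (2 * k)%:R + (2^-1 : R)); last first.
  by apply: etrans (max_r h) _; rewrite natrM -(natr1 k); lra.
rewrite powRD; last by rewrite (gt_eqF t0) implybT.
by rewrite powR_mulrn ?powR12_sqrt// ltW.
Qed.

Lemma Rintegral_ae_eq D (u v : R -> R) : measurable D -> measurable_fun D u ->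
  measurable_fun D v -> ae_eq mu D u v ->
  \int[mu]_(x in D) u x = \int[mu]_(x in D) v x.
Proof.
move=> mD mu_ mv uv; congr fine; apply: ae_eq_integral => //; try exact/measurable_EFinP.
by apply: ae_imply uv => x h /h ->.
Qed.

(** Real and imaginary parts are treated separately, so that the calculus above
    is only needed for real functions. *)
Lemma transformed_weak_derivs m (psi : R -> R) (h w : R -> R) (H G : nat -> R -> R) :
  transformation psi ->
  (forall l, (l <= m)%N -> deriv_in_C0 l (density psi)) ->
  (forall k, (k <= m)%N -> weak_deriv_real setT k h (H k)) ->
  (forall k, (k <= m)%N -> square_integrable setT (H k)) ->
  (forall k, (k <= m)%N -> weak_deriv_real I k w (G k)) ->
  (forall j k, (j + k <= m)%N -> exists C, {ae mu, forall x, I x ->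
    `|G j x| * derive1 psi x `^ Num.max (- 2^-1) (2 * k%:R - 3 / 2) <= C}) ->
  square_integrable I (fun x => h (psi x) * w x) /\
  exists E : nat -> R -> R, forall n, (n <= m)%N -> square_integrable I (E n) /\
    forall phi, smooth phi ->
      \int[mu]_(x in I) (h (psi x) * w x * derive1n n phi x) =
      (-1) ^+ n * \int[mu]_(x in I) (E n x * phi x).
Proof.
move=> tpsi rho_C0 dH sH dG bG.
have mI := @unit_itv_measurable R.
have itvT : is_interval [set: R] by move=> *.
have [A [eA0 eA mA pA]] := weak_deriv_chain openT itvT (ex_intro _ 0 Logic.I) dH.
have [D [eD0 eD mD pD]] := weak_deriv_chain (@unit_itv_open R)
  (@unit_itv_interval R) (@unit_itv_neq0 R) dG.
have A_L2 k : (k <= m)%N -> square_integrable setT (A k).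
  by move=> km; apply: (square_integrable_ae _ (mA k km) (eA k km) (sH k km)).
have D_bound j k : (j + k <= m)%N -> exists C, {ae mu, forall x, I x ->
    `|D j x| * derive1 psi x `^ Num.max (- 2^-1) (2 * k%:R - 3 / 2) <= C}.
  move=> jkm; have [C bC] := bG j k jkm; exists C.
  have jm : (j <= m)%N by exact: leq_trans (leq_addr k j) jkm.
  by apply: ae_imply2 bC (eD j jm) => x h1 h2 Ix; rewrite -h2//; exact: h1.
have D_bound0 n : (n <= m)%N ->
    exists C, {ae mu, forall x, I x -> `|D n x| <= C * Num.sqrt (derive1 psi x)}.
  move=> nm; have [|C bC] := D_bound n 0%N; first by rewrite addn0.
  exists C; apply: ae_imply bC => x + Ix => /(_ Ix).
  have p0 := dpsi_gt0 tpsi Ix.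
  by rewrite weight_exponent0// ler_pdivrMr// sqrtr_gt0.
have D_bound1 j k : (j + k < m)%N -> exists C, {ae mu, forall x, I x ->
    `|D j x| * derive1 psi x ^+ (2 * k) * Num.sqrt (derive1 psi x) <= C}.
  move=> jkm; have [|C bC] := D_bound j k.+1; first by rewrite addnS.
  exists C; apply: ae_imply bC => x + Ix => /(_ Ix).
  by rewrite weight_exponentS ?dpsi_gt0// mulrA.
have fin_I : (mu I < +oo)%E.
  by rewrite /unit_itv /= lebesgue_measure_itv/=; case: ifP => _; rewrite ?ltry.
have sums_L2 n F : (n <= m)%N -> derivative_sum psi A D n F -> square_integrable I F.
  exact: (derivative_sum_L2 tpsi rho_C0 A_L2 mD D_bound0 D_bound1).
have [_ rho_right rho_left] := rho_C0 0%N (leq0n m).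
rewrite derive1n0 in rho_right rho_left.
have step n F : (n < m)%N -> derivative_sum psi A D n F ->
  exists2 F', derivative_sum psi A D n.+1 F' & forall phi, smooth phi ->
    \int[mu]_(x in I) (F x * derive1 phi x) = - \int[mu]_(x in I) (F' x * phi x).
  move=> nm TF.
  have [F' TF' pF] := derivative_sum_prim tpsi rho_C0 pA pD nm TF.
  have [C bC] := derivative_sum_decay tpsi rho_C0 pA A_L2 pD D_bound1 nm TF.
  exists F' => // chi schi.
  apply: (torus_integration_by_parts tpsi rho_right rho_left pF _ _ bC schi).
  - exact: square_integrable_integrable (sums_L2 _ _ (ltnW nm) TF).
  - exact: square_integrable_integrable (sums_L2 _ _ nm TF').
pose F0 x := A 0%N (psi x) * D 0%N x.
have T0 : derivative_sum psi A D 0 F0 by exact: TermWeight.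
have chain n : (n <= m)%N -> exists2 F, derivative_sum psi A D n F &
  forall phi, smooth phi -> \int[mu]_(x in I) (F0 x * derive1n n phi x) =
    (-1) ^+ n * \int[mu]_(x in I) (F x * phi x).
  elim: n => [_|n IH nm].
    by exists F0 => // phi _; rewrite expr0 mul1r derive1n0.
  have [F TF eF] := IH (ltnW nm).
  have [F' TF' eF'] := step n F nm TF.
  exists F' => // phi sphi; rewrite derive1Sn eF ?eF'//.
    by rewrite exprS mulrN mulN1r mulNr.
  move=> k; have [d1 d2] := sphi k.+1; split=> [l lk x xA|].
    by rewrite -derive1Sn; apply: d1.
  by rewrite -derive1Sn.
have [lh _ _] := dH 0%N (leq0n m); have [lw _ _] := dG 0%N (leq0n m).
have mh : measurable_fun setT h by case: lh.
have mw : measurable_fun I w by case: lw.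
have mf : measurable_fun I (fun x => h (psi x) * w x).
  by apply: measurable_funM => //; exact: (measurableT_comp mh (psi_measurable tpsi)).
have sF0 := sums_L2 0%N F0 (leq0n m) T0.
have ef : ae_eq mu I (fun x => h (psi x) * w x) F0.
  have eh : {ae mu, forall x, I x -> h (psi x) = A 0%N (psi x)}.
    have : {ae mu, forall y, h y = A 0%N y} by apply: ae_imply eA0 => y; exact.
    by move=> /(ae_psi tpsi).
  by apply: ae_imply2 eh eD0 => x h1 h2 Ix; rewrite h1// h2.
split; first exact: square_integrable_ae (ae_eq_sym ef) sF0.
have [E hE] : exists E : nat -> R -> R, forall n, (n <= m)%N ->
    derivative_sum psi A D n (E n) /\ forall phi, smooth phi ->
    \int[mu]_(x in I) (F0 x * derive1n n phi x) =
    (-1) ^+ n * \int[mu]_(x in I) (E n x * phi x).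
  have ex n : exists F, (n <= m)%N -> derivative_sum psi A D n F /\
      forall phi, smooth phi -> \int[mu]_(x in I) (F0 x * derive1n n phi x) =
      (-1) ^+ n * \int[mu]_(x in I) (F x * phi x).
    have [nm|_] := boolP (n <= m)%N; last by exists (fun=> 0).
    by have [F TF eF] := chain n nm; exists F.
  by have [E hE] := choice ex; exists E.
exists E => n nm; have [TE eE] := hE n nm; split; first exact: sums_L2 TE.
move=> phi sphi; rewrite -eE//; have [mF0 _] := sF0.
have mphi : measurable_fun I (derive1n n phi).
  apply: (measurable_funS measurableT) => //; apply: continuous_measurable_fun => x.
  by have [_ c] := sphi n; apply: c; rewrite inE.
apply: Rintegral_ae_eq => //; try exact: measurable_funM.
by apply: ae_imply ef => x h1 Ix; rewrite h1.
Qed.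

End RealTheorem.

(** * Complex-valued functions *)

Section ComplexAssembly.
Context {R : realType}.
Notation mu := (@lebesgue_measure R).
Notation I := (@unit_itv R).
Implicit Types (D : set R) (u v : R -> R[i]).

Let re (u : R -> R[i]) x := complex.Re (u x).
Let im (u : R -> R[i]) x := complex.Im (u x).

Lemma ReMreal (z : R[i]) (c : R) : complex.Re (z * c%:C) = complex.Re z * c.
Proof. by case: z => a b /=; rewrite mulr0 subr0. Qed.

Lemma ImMreal (z : R[i]) (c : R) : complex.Im (z * c%:C) = complex.Im z * c.
Proof. by case: z => a b /=; rewrite mulr0 add0r. Qed.

Lemma Re_signM n (z : R[i]) : complex.Re ((-1) ^+ n * z) = (-1) ^+ n * complex.Re z.
Proof.
by rewrite -signr_odd -[RHS]/(_ * _) -(signr_odd R); case: odd;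
  rewrite ?expr0 ?expr1 ?mul1r// !mulN1r; case: z.
Qed.

Lemma Im_signM n (z : R[i]) : complex.Im ((-1) ^+ n * z) = (-1) ^+ n * complex.Im z.
Proof.
by rewrite -signr_odd -[RHS]/(_ * _) -(signr_odd R); case: odd;
  rewrite ?expr0 ?expr1 ?mul1r// !mulN1r; case: z.
Qed.

Lemma cabs_sq (z : R[i]) : cabs z ^+ 2 = complex.Re z ^+ 2 + complex.Im z ^+ 2.
Proof. by case: z => a b; rewrite /cabs /= sqr_sqrtr// addr_ge0// sqr_ge0. Qed.

Lemma cabs_ge0 (z : R[i]) : 0 <= cabs z.
Proof. by case: z => a b; exact: sqrtr_ge0. Qed.

Lemma cabs_real (c : R) : cabs c%:C = `|c|.
Proof. by rewrite /cabs /= expr0n addr0 sqrtr_sqr. Qed.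

Lemma CintegralP D u v n : Cintegral D u = (-1) ^+ n * Cintegral D v <->
  \int[mu]_(x in D) re u x = (-1) ^+ n * \int[mu]_(x in D) re v x /\
  \int[mu]_(x in D) im u x = (-1) ^+ n * \int[mu]_(x in D) im v x.
Proof.
split=> [e|[e1 e2]].
  by split; [have := congr1 (@complex.Re R) e; rewrite Re_signM|
             have := congr1 (@complex.Im R) e; rewrite Im_signM].
by apply/eqP; rewrite eq_complex Re_signM Im_signM /= -e1 -e2 !eqxx.
Qed.

Lemma weak_deriv_components D n u v : weak_deriv D n u v ->
  weak_deriv_real D n (re u) (re v) /\ weak_deriv_real D n (im u) (im v).
Proof.
move=> [[lu1 lu2] [lv1 lv2] uv]; split; split => // phi /uv/CintegralP[e1 e2].
  rewrite /re in e1; under eq_Rintegral do rewrite -ReMreal; rewrite e1; congr (_ * _).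
  by apply: eq_Rintegral => x _; rewrite ReMreal.
rewrite /im in e2; under eq_Rintegral do rewrite -ImMreal; rewrite e2; congr (_ * _).
by apply: eq_Rintegral => x _; rewrite ImMreal.
Qed.

Lemma L2norm_lty D u : (L2norm D u < +oo)%E =
  (\int[mu]_(x in D) (cabs (u x) ^+ 2)%:E < +oo)%E.
Proof.
have <- : (L2norm D u `^ 2 = \int[mu]_(x in D) (cabs (u x) ^+ 2)%:E)%E.
  rewrite /L2norm powR_Lnorm ?pnatr_eq0// [RHS]integral_mkcond.
  apply: eq_integral => x _; rewrite !patchE; case: ifP => _.
    by rewrite poweR_EFin ger0_norm ?cabs_ge0// powR_mulrn ?cabs_ge0.
  by rewrite abse0 poweR0r// pnatr_eq0.
apply/idP/idP => [h|]; first exact: poweR_lty.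
by apply: lty_poweRy; rewrite pnatr_eq0.
Qed.

Lemma L2norm_components D u : measurable D ->
  measurable_fun D (re u) -> measurable_fun D (im u) -> (L2norm D u < +oo)%E <->
  square_integrable D (re u) /\ square_integrable D (im u).
Proof.
move=> mD m1 m2; rewrite L2norm_lty.
have -> : (\int[mu]_(x in D) (cabs (u x) ^+ 2)%:E =
    \int[mu]_(x in D) (re u x ^+ 2)%:E + \int[mu]_(x in D) (im u x ^+ 2)%:E)%E.
  rewrite -ge0_integralD//.
  - by apply: eq_integral => x _; rewrite cabs_sq EFinD.
  - by move=> x _; rewrite lee_fin sqr_ge0.
  - by apply/measurable_EFinP; exact: measurable_funX.
  - by move=> x _; rewrite lee_fin sqr_ge0.
  - by apply/measurable_EFinP; exact: measurable_funX.
have i1 : (0 <= \int[mu]_(x in D) (re u x ^+ 2)%:E)%E.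
  by apply: integral_ge0 => x _; rewrite lee_fin sqr_ge0.
have i2 : (0 <= \int[mu]_(x in D) (im u x ^+ 2)%:E)%E.
  by apply: integral_ge0 => x _; rewrite lee_fin sqr_ge0.
split=> [h|[[_ h1] [_ h2]]]; last exact: lte_add_pinfty.
by split; split => //; apply: le_lt_trans h; [exact: leeDl|exact: leeDr].
Qed.

Lemma sobolev_norm_lty D m (F : nat -> R -> R[i]) :
  (sobolev_norm D m F < +oo)%E <-> forall k, (k <= m)%N -> (L2norm D (F k) < +oo)%E.
Proof.
have S0 : (0 <= \sum_(k < m.+1) L2norm D (F k) ^+ 2)%E.
  by apply: sume_ge0 => k _; exact: sqre_ge0.
split=> [h k km|h].
  have {}h : (\sum_(k < m.+1) L2norm D (F k) ^+ 2 < +oo)%E.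
    by apply: lty_poweRy h; rewrite invr_eq0 pnatr_eq0.
  rewrite ltey; apply/eqP => Fk; move: h; rewrite (bigD1 (inord k))//= inordK// Fk.
  by rewrite addye// gt_eqF// (lt_le_trans (ltNyr 0))// sume_ge0// => i _; exact: sqre_ge0.
rewrite /sobolev_norm; apply: poweR_lty; apply: lte_sum_pinfty => k _.
have := h k (ltn_ord k).
have := Lnorm_ge0 mu 2%:E ((fun x => (cabs (F k x))%:E) \_ D); rewrite -/(L2norm D _).
by case: (L2norm D (F k)) => // r0 _ _; rewrite -EFin_expe ltry.
Qed.

Let torusE : @torus R = [set - 2^-1] `|` I.
Proof. by rewrite /torus /unit_itv setU1itv// bnd_simp; lra. Qed.

(** The torus and the open interval differ by one point. *)
Lemma torus_measurable (u : R -> R) : measurable_fun I u -> measurable_fun (@torus R) u.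
Proof.
move=> mu_; rewrite torusE; apply/measurable_funU => //; first exact: unit_itv_measurable.
by split => //; exact: measurable_fun_set1.
Qed.

Lemma torus_integral (u : R -> \bar R) : measurable_fun I u ->
  (\int[mu]_(x in @torus R) u x = \int[mu]_(x in I) u x)%E.
Proof. by move=> mu_; rewrite /torus -integral_itv_obnd_cbnd. Qed.

Lemma torus_square_integrable (u : R -> R) :
  square_integrable I u -> square_integrable (@torus R) u.
Proof.
move=> [mu_ fu]; split; first exact: torus_measurable.
by rewrite torus_integral//; apply/measurable_EFinP; exact: measurable_funX.
Qed.

Lemma torus_Rintegral (u : R -> R) : measurable_fun I u ->
  \int[mu]_(x in @torus R) u x = \int[mu]_(x in I) u x.
Proof. by move=> mu_; rewrite /Rintegral torus_integral//; exact/measurable_EFinP. Qed.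

Lemma torus_integrable (u : R -> R) :
  square_integrable I u -> mu.-integrable (@torus R) (EFin \o u).
Proof.
move=> su; apply: square_integrable_integrable.
- exact: measurable_itv.
- by rewrite /torus /= lebesgue_measure_itv/=; case: ifP => _; rewrite ?ltry.
- exact: torus_square_integrable.
Qed.

Lemma Linfnorm_bound (g : R -> R) : (Linfnorm (@torus R) (fun x => (g x)%:C) < +oo)%E ->
  exists C, {ae mu, forall x, I x -> `|g x| <= C}.
Proof.
rewrite /Linfnorm unlock /Lnorm; rewrite ifT; last first.
  have h : (0 < mu (`]-oo, +oo[%classic : set R))%E by rewrite lebesgue_measure_itv/= ltry.
  by rewrite set_itvNyy in h.
set f := (abse \o _); set e := ess_sup _ f => ey.
have := @ess_sup_ge _ _ _ mu f; rewrite -/e => fe.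
exists (fine e); apply: ae_imply fe => x + Ix.
rewrite /f [(_ \o _) x]/(abse _) patchE mem_set; last by rewrite torusE; right.
by rewrite cabs_real; move: ey; case: e => [r| |]//= _; rewrite lee_fin normr_id.
Qed.

End ComplexAssembly.

Theorem theorem3p4 (R : realType) (m : nat) (psi : R -> R)
    (psi_transf : transformation psi)
    (omega : R -> R)
    (omega_meas : measurable_fun setT omega)
    (omega_ge0 : forall y, 0 <= omega y)
    (h : R -> R[i])
    (h_wL2 : in_wL2 omega h)
    (h_Hm : in_Hm_real m h)
    (rho_C0 : forall l, (l <= m)%N -> deriv_in_C0 l (density psi))
    (psi_C : forall l, (l <= m)%N -> cont_deriv_on unit_itv l psi)
    (G : nat -> R -> R)
    (G_deriv : forall n, (n <= m)%N ->
       weak_deriv unit_itv n (fun x => (transf_weight psi omega x)%:C)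
                             (fun x => (G n x)%:C))
    (G_bound : forall l, (l <= m)%N ->
       (\big[maxe/0]_(k < l.+1)
          Linfnorm torus (fun x =>
            ((G (l - k)%N x *
             derive1 psi x `^ Num.max (- 2^-1) (2 * k%:R - 3 / 2))%:C)%R)
        < +oo)%E) :
  in_Hm_torus m (transformed psi omega h).
Proof.
set w := transf_weight psi omega; pose f := transformed psi omega h.
have [_ [H [dH nH]]] := h_Hm.
have dHc k (km : (k <= m)%N) := weak_deriv_components (dH k km).
have sH k : (k <= m)%N -> square_integrable setT (fun x => complex.Re (H k x)) /\
    square_integrable setT (fun x => complex.Im (H k x)).
  move=> km; have [[_ [m1 _ _] _] [_ [m2 _ _] _]] := dHc k km.
  by apply/(L2norm_components measurableT m1 m2); exact: (sobolev_norm_lty _ _ _).1 nH k km.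
have dG k (km : (k <= m)%N) : weak_deriv_real unit_itv k w (G k).
  by have [] := weak_deriv_components (G_deriv k km).
have bG j k : (j + k <= m)%N -> exists C, {ae (@lebesgue_measure R), forall x, unit_itv x ->
    `|G j x| * derive1 psi x `^ Num.max (- 2^-1) (2 * k%:R - 3 / 2) <= C}.
  move=> jkm; have kl : (k < (j + k).+1)%N by rewrite ltnS leq_addl.
  have := le_lt_trans (le_bigmax _ _ (Ordinal kl)) (G_bound (j + k)%N jkm).
  rewrite /= addnK => /Linfnorm_bound[C bC]; exists C.
  by apply: ae_imply bC => x + Ix => /(_ Ix); rewrite normrM (ger0_norm (powR_ge0 _ _)).
have [sf1 [E1 hE1]] := transformed_weak_derivs psi_transf rho_C0
  (fun k km => (dHc k km).1) (fun k km => (sH k km).1) dG bG.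
have [sf2 [E2 hE2]] := transformed_weak_derivs psi_transf rho_C0
  (fun k km => (dHc k km).2) (fun k km => (sH k km).2) dG bG.
have mT : measurable (@torus R) by exact: measurable_itv.
have ReF x : complex.Re (f x) = complex.Re (h (psi x)) * w x by exact: ReMreal.
have ImF x : complex.Im (f x) = complex.Im (h (psi x)) * w x by exact: ImMreal.
rewrite -(funext ReF : (fun x => _) = _) in sf1.
rewrite -(funext ImF : (fun x => _) = _) in sf2.
have in_L2T u : square_integrable unit_itv (fun x => complex.Re (u x)) ->
    square_integrable unit_itv (fun x => complex.Im (u x)) -> in_L2 (@torus R) u.
  move=> /torus_square_integrable s1 /torus_square_integrable s2.
  have [[m1 _] [m2 _]] := (s1, s2); split; first by split.
  by apply/(L2norm_components mT m1 m2).
split; first exact: in_L2T.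
pose F k x : R[i] := E1 k x +i* E2 k x.
exists F; split=> [n nm|]; last first.
  apply/sobolev_norm_lty => k km; have [//|//|_ ->//] := in_L2T (F k).
  - by have [] := hE1 k km.
  - by have [] := hE2 k km.
have [s1 e1] := hE1 n nm; have [s2 e2] := hE2 n nm.
split; [by split; exact: torus_integrable|by split; exact: torus_integrable|].
move=> phi [sphi _]; apply/CintegralP.
have mphi k : measurable_fun unit_itv (derive1n k phi).
  apply: (measurable_funS measurableT) => //; apply: continuous_measurable_fun => x.
  by have [_ c] := sphi k; apply: c; rewrite inE.
have mul (u : R -> R) k : square_integrable unit_itv u ->
    measurable_fun unit_itv (fun x => u x * derive1n k phi x).
  by move=> [mu_ _]; exact: measurable_funM.
have comp (g v : R -> R) k : square_integrable unit_itv v -> g = (fun x => v x * derive1n k phi x) ->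
    \int[lebesgue_measure]_(x in @torus R) g x =
    \int[lebesgue_measure]_(x in unit_itv) (v x * derive1n k phi x).
  by move=> sv ->; apply: torus_Rintegral; exact: mul.
split.
  rewrite (comp _ _ n sf1); last by apply/funext => x; rewrite ReMreal.
  rewrite (comp _ _ 0%N s1); last by apply/funext => x; rewrite ReMreal.
  by rewrite -e1//; apply: eq_Rintegral => x _; rewrite ReF.
rewrite (comp _ _ n sf2); last by apply/funext => x; rewrite ImMreal.
rewrite (comp _ _ 0%N s2); last by apply/funext => x; rewrite ImMreal.
by rewrite -e2//; apply: eq_Rintegral => x _; rewrite ImF.
Qed.
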